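(* Let $\mathcal{H}$ be a well-behaved family of graphs and let $\Pi=$ \textsc{Independent Set}. Then the following are equivalent: (1) $\Pi$ admits an FPT-AS parameterized by $\mathbf{mod}_{\mathcal{H}}(\cdot)$ and $\epsilon$; (2) $\Pi$ admits an FPT-AS parameterized by $\mathbf{ed}_{\mathcal{H}}(\cdot)$ and $\epsilon$; (3) $\Pi$ admits an FPT-AS parameterized by $\mathbf{tw}_{\mathcal{H}}(\cdot)$ and $\epsilon$.
   Context: A family is well-behaved if hereditary and closed under disjoint union. \textsc{Independent Set}: find a maximum-size set of pairwise non-adjacent vertices. An FPT-AS parameterized by $p$ and $\epsilon$ returns an independent set of size at least $(1-\epsilon)\mathrm{OPT}$ in time $f(p,\epsilon)n^{O(1)}$, $f$ computable; by convention it is given a modulator / decomposition of size / depth / width equal to the parameter. $\mathbf{mod}_{\mathcal{H}}(G)$: minimum $|S|$ with $G-S\in\mathcal{H}$. $\mathcal{H}$-elimination decomposition $(T,\chi,L)$: $T$ rooted forest, $\chi:V(T)\to 2^{V(G)}$, $L\subseteq V(G)$; internal nodes have $|\chi(t)|\le1$, $\chi(t)\cap L=\emptyset$; bags partition $V(G)$; each leaf bag lies in $L$ and induces a graph of $\mathcal{H}$, leaf bags partition $L$; each edge joins bags of nodes in ancestor–descendant relation; $\mathbf{ed}_{\mathcal{H}}(G)$ = minimum depth (edges on a longest root-to-leaf path). $\mathcal{H}$-tree decomposition $(T,\chi,L)$: $T$ rooted tree; bags containing a vertex form a nonempty connected subtree; each edge in a bag; each $v\in L$ in the bag of a unique node,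 which is a leaf; for each leaf $t$, $G[\chi(t)\cap L]\in\mathcal{H}$; width $\max\{0,\max_t|\chi(t)\setminus L|-1\}$; $\mathbf{tw}_{\mathcal{H}}(G)$ = minimum width. *)

(* Defs.v *)
From HB Require Import structures.
From mathcomp Require Import all_boot all_order all_algebra.

Set Implicit Arguments.
Unset Strict Implicit.
Unset Printing Implicit Defensive.

Record sgraph := SGraph {
  vertex :> finType;
  edge : rel vertex;
  edge_sym : symmetric edge;
  edge_irr : irreflexive edge }.

Section Induced.
Variables (G : sgraph) (A : {set G}).

Definition ind_edge : rel {x : G | x \in A} :=
  fun x y => edge (val x) (val y).

Lemma ind_edge_sym : symmetric ind_edge.
Proof. by move=> x y; apply: edge_sym. Qed.

Lemma ind_edge_irr : irreflexive ind_edge.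
Proof. by move=> x; apply: edge_irr. Qed.

Definition induced : sgraph := SGraph ind_edge_sym ind_edge_irr.
End Induced.

Section DisjointUnion.
Variables G1 G2 : sgraph.

Definition union_edge : rel (G1 + G2)%type := fun x y =>
  match x, y with
  | inl u, inl v => edge u v
  | inr u, inr v => edge u v
  | _, _ => false
  end.

Lemma union_edge_sym : symmetric union_edge.
Proof. by move=> [x|x] [y|y] //=; apply: edge_sym. Qed.

Lemma union_edge_irr : irreflexive union_edge.
Proof. by move=> [x|x] /=; apply: edge_irr. Qed.

Definition disjoint_union : sgraph := SGraph union_edge_sym union_edge_irr.
End DisjointUnion.

Definition isomorphic (G1 G2 : sgraph) : Prop :=
  exists2 f : G1 -> G2, bijective f & forall x y, edge (f x) (f y) = edge x y.

Definition graph_family := sgraph -> Prop.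

(* As usual, a family of graphs does not depend on the names of the vertices,
   hence the first clause. *)
Definition well_behaved (H : graph_family) : Prop :=
  [/\ forall G1 G2, isomorphic G1 G2 -> H G1 -> H G2,
      forall (G : sgraph) (A : {set G}), H G -> H (induced A)
    & forall G1 G2, H G1 -> H G2 -> H (disjoint_union G1 G2)].

Definition independent (G : sgraph) (I : {set G}) : bool :=
  [forall x in I, forall y in I, ~~ edge x y].

Definition opt (G : sgraph) : nat := \max_(I : {set G} | independent I) #|I|.

Record forest := Forest {
  node :> finType;
  parent : node -> option node;
  parent_wf : forall t, exists k, iter k (obind parent) (Some t) = None }.

Definition is_root (F : forest) (t : F) : bool := parent t == None.

Definition is_leaf (F : forest) (t : F) : bool :=
  [forall s : F, parent s != Some t].

Definition is_tree (F : forest) : bool := #|[set t : F | is_root t]| == 1.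

(* Every node is an ancestor of itself. *)
Definition ancestor (F : forest) (a t : F) : bool :=
  connect [rel x y : F | parent x == Some y] t a.

(* The number of proper ancestors of t is the number of edges on the path
   from the root to t. *)
Definition node_depth (F : forest) (t : F) : nat :=
  #|[set a : F | ancestor a t & a != t]|.

Definition depth (F : forest) : nat := \max_(t : F | is_leaf t) node_depth t.

Definition tree_adj (F : forest) : rel F :=
  fun s t => (parent s == Some t) || (parent t == Some s).

Definition connected_in (F : forest) (X : {set F}) : Prop :=
  forall s t : F, s \in X -> t \in X ->
    connect [rel x y : F | [&& x \in X, y \in X & tree_adj x y]] s t.

(* The triples (T, chi, L). *)
Record decomposition (G : sgraph) := Decomposition {
  dforest :> forest;
  bag : dforest -> {set G};
  base : {set G} }.

Definition is_modulator (H : graph_family) (G : sgraph) (S : {set G}) : Prop :=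
  H (induced (~: S)).

(* Bags may be empty, so "partition" is meant for the indexed family of bags:
   each vertex is in the bag of exactly one node. *)
Definition is_elim_decomposition (H : graph_family) (G : sgraph)
    (D : decomposition G) : Prop :=
  [/\ forall t : D, ~~ is_leaf t ->
        #|bag t| <= 1 /\ [disjoint bag t & base D],
      forall v : G, exists! t : D, v \in bag t,
      forall t : D, is_leaf t -> bag t \subset base D /\ H (induced (bag t)),
      forall v : G, v \in base D -> exists! t : D, is_leaf t /\ v \in bag t
    & forall (u v : G) (s t : D), edge u v -> u \in bag s -> v \in bag t ->
        ancestor s t || ancestor t s].

Definition is_tree_decomposition (H : graph_family) (G : sgraph)
    (D : decomposition G) : Prop :=
  [/\ is_tree D,
      forall v : G, (exists t : D, v \in bag t) /\
        connected_in [set t : D | v \in bag t],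
      forall u v : G, edge u v ->
        exists t : D, u \in bag t /\ v \in bag t,
      forall v : G, v \in base D ->
        exists2 t : D, is_leaf t & forall s : D, (v \in bag s) = (s == t)
    & forall t : D, is_leaf t -> H (induced (bag t :&: base D))].

(* The truncated predecessor accounts for the outer max{0, _}. *)
Definition width (G : sgraph) (D : decomposition G) : nat :=
  (\max_(t : D) #|bag t :\: base D|).-1.

(* Model of computation: the weak call-by-value lambda-calculus with de Bruijn
   indices; time is the number of beta-steps.  This measure is polynomially
   related to Turing machine time (Dal Lago and Martini; Forster, Kunze and
   Roth), hence it yields the usual notions of computable function and of
   running time f(p, eps) * n^O(1). *)

Inductive term : Type :=
  | var of nat
  | app of term & term
  | lam of term.

(* Substitution is only used with a closed u, so no lifting is needed. *)
Fixpoint subst (s : term) (k : nat) (u : term) : term :=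
  match s with
  | var n => if n == k then u else var n
  | app s1 s2 => app (subst s1 k u) (subst s2 k u)
  | lam s1 => lam (subst s1 k.+1 u)
  end.

Fixpoint bound (k : nat) (s : term) : bool :=
  match s with
  | var n => n < k
  | app s1 s2 => bound k s1 && bound k s2
  | lam s1 => bound k.+1 s1
  end.

Definition closed_term (s : term) : bool := bound 0 s.

Fixpoint tsize (s : term) : nat :=
  match s with
  | var n => n.+1
  | app s1 s2 => (tsize s1 + tsize s2).+1
  | lam s1 => (tsize s1).+1
  end.

(* evals s k v: s reduces to the value v in k beta-steps. *)
Inductive evals : term -> nat -> term -> Prop :=
  | evals_lam s : evals (lam s) 0 (lam s)
  | evals_app s t s' t' v k1 k2 k3 :
      evals s k1 (lam s') -> evals t k2 (lam t') ->
      evals (subst s' 0 (lam t')) k3 v ->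
      evals (app s t) (k1 + k2 + k3).+1 v.

(* Scott encodings; numbers are in unary, which is harmless here since vertices
   and nodes are numbered from 0 and the encoding of eps is part of the
   parameter. *)

Definition enc_bool (b : bool) : term := lam (lam (var (if b then 1 else 0))).

Fixpoint enc_nat (n : nat) : term :=
  if n is n'.+1 then lam (lam (app (var 0) (enc_nat n')))
  else lam (lam (var 1)).

Definition enc_pair (a b : term) : term := lam (app (app (var 0) a) b).

Definition enc_option (T : Type) (enc : T -> term) (o : option T) : term :=
  if o is Some x then lam (lam (app (var 1) (enc x))) else lam (lam (var 0)).

Fixpoint enc_list (T : Type) (enc : T -> term) (s : seq T) : term :=
  if s is x :: s' then lam (lam (app (app (var 0) (enc x)) (enc_list enc s')))
  else lam (lam (var 1)).

Definition enc_elt (T : finType) (x : T) : term := enc_nat (enum_rank x).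

Definition enc_set (T : finType) (A : {set T}) : term :=
  enc_list (@enc_elt T) (enum A).

Definition enc_graph (G : sgraph) : term :=
  enc_list (fun x => enc_list (fun y => enc_bool (edge x y)) (enum G)) (enum G).

Definition enc_decomposition (G : sgraph) (D : decomposition G) : term :=
  enc_pair
    (enc_list (fun t : D =>
       enc_pair (enc_option (@enc_elt D) (parent t)) (enc_set (bag t)))
       (enum D))
    (enc_set (base D)).

Definition enc_rat (q : rat) : term :=
  enc_pair (enc_nat `|numq q|%N) (enc_nat `|denq q|%N).

Definition is_eps (eps : rat) : bool := (0 < eps < 1)%R.

Definition computable_bound (f : nat -> rat -> nat) : Prop :=
  exists2 F : term, closed_term F & forall (p : nat) (eps : rat), is_eps eps ->
    exists k, evals (app (app F (enc_nat p)) (enc_rat eps)) k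
                    (enc_nat (f p eps)).

(* A graph parameter defined as the least measure of a valid witness
   (a modulator or a decomposition) *)
Record parameter := GraphParam {
  witness : sgraph -> Type;
  wvalid : forall G, witness G -> Prop;
  wmeasure : forall G, witness G -> nat;
  enc_witness : forall G, witness G -> term }.

Definition param_value (P : parameter) (G : sgraph) (p : nat) : Prop :=
  (exists2 w : witness P G, wvalid w & wmeasure w = p) /\
  (forall w : witness P G, wvalid w -> p <= wmeasure w).

Definition mod_param (H : graph_family) : parameter :=
  @GraphParam (fun G => {set G}) (@is_modulator H)
    (fun G S => #|S|) (fun G => @enc_set G).

Definition ed_param (H : graph_family) : parameter :=
  @GraphParam decomposition (@is_elim_decomposition H)
    (fun G D => depth D) enc_decomposition.

Definition tw_param (H : graph_family) : parameter :=
  @GraphParam decomposition (@is_tree_decomposition H)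
    width enc_decomposition.

(* In the time bound, n is the size of the input (G, w): a decomposition may
   have many more nodes than G has vertices. *)
Definition independent_set_fptas (P : parameter) : Prop :=
  exists (A : term) (f : nat -> rat -> nat) (c : nat),
    [/\ closed_term A, computable_bound f &
      forall (G : sgraph) (w : witness P G) (p : nat) (eps : rat),
        param_value P G p -> wvalid w -> wmeasure w = p -> is_eps eps ->
        let n := tsize (enc_graph G) + tsize (enc_witness w) in
        exists (k : nat) (s : seq G),
          [/\ evals (app (app (app A (enc_graph G)) (enc_witness w))
                         (enc_rat eps))
                    k (enc_list (@enc_elt G) s),
              k <= f p eps * n ^ c,
              uniq s, independent [set x in s]
            & ((1 - eps) * (opt G)%:R <= (size s)%:R)%R]].

(* Main.v *)
(* All three statements are equivalent to (0): Independent Set restricted to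
   the graphs of H has a (1 - eps)-approximation in time f(eps) n^O(1).

   A graph of H has the empty modulator, and the decomposition with a single
   node, whose bag and base are the whole vertex set, has depth and width 0;
   hence each of the three schemes, run on these witnesses with parameter 0,
   gives (0).  (Optimality of the witness is thus never an issue.)

   Conversely, given (0), a tree decomposition (T, chi, L) of width w is
   handled by dynamic programming: the table of a node t contains, for each
   independent X included in chi(t) \ L, an independent set of the graph below
   t that extends X; it consists of X, of the approximate solution given by (0)
   on (chi(t) & L) \ N(X), which is a graph of H, and, for each child of t, of
   the largest entry of its table, restricted to the complement of chi(t) \ L,
   that has no edge to X.  A modulator S is turned into the decomposition with
   one node and base V \ S, and an elimination decomposition into a tree
   decomposition by adding to each bag the bags of the ancestors of the node.

   All costs are polynomial in a single number N that bounds the numbers of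
   vertices and nodes, 2^(p+1) and f(eps); with N = n * 2^(p+1) * (f(eps)+1),
   a bound N^d splits as required. *)

From HB Require Import structures.
From mathcomp Require Import all_boot all_order all_algebra zify.
From Stdlib Require Import Classical IndefiniteDescription.
Require Import Defs.

Set Implicit Arguments.
Unset Strict Implicit.
Unset Printing Implicit Defensive.

Import Order.TTheory GRing.Theory Num.Theory.

(** * The lambda-calculus *)

(** The nodes come in an arbitrary order with parent pointers only, so the tables are not filled
    bottom-up: all of them are recomputed in simultaneous rounds, as many as there are nodes. After
    [i] rounds a table knows only the nodes fewer than [i] steps below its own; its entries are
    independent at every round, and the last round is complete because every node has a root fewer
    than [#|D|] steps above it. The factor [1 - eps] is not compounded along the tree, because sizes
    of disjoint pieces are added: core vertices (those outside [base D]) are guessed exactly, base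
    vertices are approximated node by node. All decompositions meet in the predicate [good], which
    asks for what the recursion uses and lets any bag contain base vertices. The programs never
    compute [N]: it lives in the cost lemmas only. There it must bound the length of every list,
    which relies on soundness, since duplicate-free lists of vertices are short. The factor [f], by
    contrast, must be computed by a term, whence the unary arithmetic. *)

Definition is_lam (t : term) : bool := if t is lam _ then true else false.
Definition is_value (t : term) : bool := is_lam t && closed_term t.

Lemma bound_leq k m t : k <= m -> bound k t -> bound m t.
Proof.
elim: t k m => [n|s IHs t IHt|s IHs] k m le_km /=.
- by move/leq_trans; apply.
- by move/andP=> [/(IHs _ _ le_km)-> /(IHt _ _ le_km)->].
- exact: IHs.
Qed.

Lemma subst_bound t k u : bound k t -> subst t k u = t.
Proof.
elim: t k => [n|s IHs t IHt|s IHs] k /=.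
- by move=> lt_nk; rewrite ltn_eqF.
- by move/andP=> [/IHs-> /IHt->].
- by move/IHs->.
Qed.

Lemma bound_value t k : is_value t -> bound k t.
Proof. by move/andP=> [_]; apply: bound_leq. Qed.

Lemma subst_value t k u : is_value t -> subst t k u = t.
Proof. by move=> /(bound_value k) /subst_bound. Qed.

(** An upper bound instead of an exact count, so that costs can be rounded up whenever runs are
    composed. *)
Definition runs (s : term) (K : nat) (v : term) : Prop :=
  exists2 k, k <= K & evals s k v.

(** A substitute for small-step reduction on top of the big-step [evals]. Phrased through final
    results, it composes by adding costs and is a congruence on both sides of [app], which is what
    the symbolic execution of a program needs. *)
Definition steps (s : term) (K : nat) (s' : term) : Prop :=
  forall K' v, runs s' K' v -> runs s (K + K') v.

Lemma evals_is_lam s k v : evals s k v -> is_lam v.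
Proof. by elim. Qed.

Lemma evals_value v : is_lam v -> evals v 0 v.
Proof. by case: v => // s _; constructor. Qed.

Lemma runs_value v : is_value v -> runs v 0 v.
Proof. by move=> /andP[lv _]; exists 0 => //; apply: evals_value. Qed.

Lemma runs_leq s K K' v : runs s K v -> K <= K' -> runs s K' v.
Proof. by move=> [k le_k e] le_K; exists k => //; apply: leq_trans le_K. Qed.

(** A value evaluates only to itself, so a complete run can be replayed as a step inside a larger
    term; this is how a verified program is called as a subroutine. *)
Lemma steps_runs s K v : runs s K v -> steps s K v.
Proof.
move=> [k le_k e] K' w [k' _ e'].
have lv := evals_is_lam e.
suff <- : v = w by exists k => //; apply: leq_trans le_k (leq_addr _ _).
by case: v lv e e' => // b _ _ e'; inversion e'.
Qed.

Lemma runs_steps s K s' K' v : steps s K s' -> runs s' K' v -> runs s (K + K') v.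
Proof. exact. Qed.

Lemma evals_appP s t k v : evals (app s t) k v ->
  exists s' t' k1 k2 k3, [/\ evals s k1 (lam s'), evals t k2 (lam t'),
    evals (subst s' 0 (lam t')) k3 v & k = (k1 + k2 + k3).+1].
Proof.
by move=> e; inversion e; subst; do 5 eexists; split; eauto.
Qed.

Lemma steps_appl s K s' t : steps s K s' -> steps (app s t) K (app s' t).
Proof.
move=> st K' v [k le_k /evals_appP [b [u [k1 [k2 [k3 [e1 e2 e3 def_k]]]]]]].
have [m le_m e] := st k1 (lam b) (ex_intro2 _ _ k1 (leqnn _) e1).
exists (m + k2 + k3).+1; first by lia.
exact: evals_app e e2 e3.
Qed.

Lemma steps_appr s t K t' : steps t K t' -> steps (app s t) K (app s t').
Proof.
move=> st K' v [k le_k /evals_appP [b [u [k1 [k2 [k3 [e1 e2 e3 def_k]]]]]]].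
have [m le_m e] := st k2 (lam u) (ex_intro2 _ _ k2 (leqnn _) e2).
exists (k1 + m + k3).+1; first by lia.
exact: evals_app e1 e e3.
Qed.

Lemma steps_trans s K s' K' s'' :
  steps s K s' -> steps s' K' s'' -> steps s (K + K') s''.
Proof. by move=> st st' L v r; rewrite -addnA; apply/st/st'. Qed.

Lemma steps_beta b u : is_value u -> steps (app (lam b) u) 1 (subst b 0 u).
Proof.
move=> /andP[lu _] K v [k le_k e].
exists k.+1; first by rewrite add1n.
case: u lu e => // u _ e.
have := evals_app (evals_lam b) (evals_lam u) e.
by rewrite !add0n.
Qed.

(* Programs are written with Rocq binders: a term is a function of the number
   of binders above it, and a bound variable computes its own index. *)
Definition hterm := nat -> term.
Definition hlam (f : hterm -> hterm) : hterm :=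
  fun d => lam (f (fun d' => var (Nat.sub d' d.+1)) d.+1).
Definition happ (s t : hterm) : hterm := fun d => app (s d) (t d).
(** Ignoring the binder depth is right for closed terms, where no index has to be shifted. *)
Definition hcst (t : term) : hterm := fun _ => t.
Coercion hcst : term >-> hterm.

Notation "s $ t" := (happ s t) (at level 39, left associativity).
Notation "'fn' x .. y => t" := (hlam (fun x => .. (hlam (fun y => t)) ..))
  (at level 200, x binder, y binder, right associativity).

Definition program (h : hterm) : term := h 0.

Create HintDb val.

Lemma value_nat n : is_value (enc_nat n).
Proof.
case: n => [|n] //; rewrite /is_value /closed_term /=.
by elim: n => //= n /(bound_leq (leq_addl 2 2)).
Qed.

Lemma value_closed t : is_value t -> closed_term t.
Proof. by case/andP. Qed.

Lemma bound_closed k t : closed_term t -> bound k t.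
Proof. exact: bound_leq. Qed.

Lemma subst_closed t k u : closed_term t -> subst t k u = t.
Proof. by move=> /(bound_closed k) /subst_bound. Qed.

Lemma value_bool b : is_value (enc_bool b).
Proof. by case: b. Qed.

Lemma value_pair a b : is_value a -> is_value b -> is_value (enc_pair a b).
Proof. by move=> va vb; rewrite /is_value /closed_term /= !bound_value. Qed.

Lemma value_list T (e : T -> term) l :
  (forall x, is_value (e x)) -> is_value (enc_list e l).
Proof.
by move=> ve; elim: l => //= x l IHl; rewrite /is_value /closed_term /= !bound_value.
Qed.

Lemma value_option T (e : T -> term) o :
  (forall x, is_value (e x)) -> is_value (enc_option e o).
Proof.
by move=> ve; case: o => //= x; rewrite /is_value /closed_term /= bound_value.
Qed.

Lemma value_elt (T : finType) (x : T) : is_value (enc_elt x).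
Proof. exact: value_nat. Qed.

Ltac value_tac :=
  lazymatch goal with
  | |- forall _, _ => intro; cbv beta; value_tac
  | |- is_true (is_value (enc_nat _)) => apply: value_nat
  | |- is_true (is_value (enc_bool _)) => apply: value_bool
  | |- is_true (is_value (enc_elt _)) => apply: value_elt
  | |- is_true (is_value (enc_pair _ _)) => apply: value_pair; value_tac
  | |- is_true (is_value (enc_list _ _)) => apply: value_list; value_tac
  | |- is_true (is_value (enc_option _ _)) => apply: value_option; value_tac
  | |- is_true (is_value (lam _)) => rewrite /is_value /closed_term /=; bound_tac
  | |- is_true (is_value (app _ _)) => fail
  | |- is_true (is_value _) => solve [assumption | auto 3 with val | eauto 2]
  end
with bound_tac :=
  lazymatch goal with
  | |- is_true (_ && _) => apply/andP; split; bound_tac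
  | |- is_true (bound _ _) => apply: bound_closed; closed_tac
  | |- _ => done
  end
with closed_tac :=
  first [assumption | apply: value_closed; value_tac].

Ltac subst_tac :=
  simpl;
  repeat match goal with
  | |- context [subst ?t ?k ?u] =>
      rewrite (@subst_closed t k u); [ | closed_tac ]
  end.

Ltac in_context tac :=
  first [ tac tt | apply: steps_appr; in_context tac
        | apply: steps_appl; in_context tac ].

Ltac beta := eapply runs_steps;
  [ in_context ltac:(fun _ => lazymatch goal with |- steps (app (lam _) _) _ _ =>
      eapply steps_beta; value_tac end) | subst_tac ].
Ltac betas := repeat beta.

Ltac step lem := eapply runs_steps;
  [ in_context ltac:(fun _ => eapply lem) | ].

Tactic Notation "call" uconstr(lem) := eapply runs_steps;
  [ in_context ltac:(fun _ => eapply steps_runs; unshelve (eapply lem);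
      first [value_tac | assumption | idtac]) | ].

Ltac finish := eapply runs_leq; [ | ].
Ltac expose := cbv [program hlam happ hcst Nat.sub].
Ltac unfold_program f := rewrite /f; expose.
Ltac ret := apply: runs_value; value_tac.

Lemma steps_beta2 b s t : is_value s -> is_value t ->
  steps (app (app (lam (lam b)) s) t) 2 (subst (subst b 1 s) 0 t).
Proof.
move=> vs vt; apply: (@steps_trans _ 1 (app (lam (subst b 1 s)) t) 1).
  exact/steps_appl/(@steps_beta (lam b)).
exact: steps_beta.
Qed.

Section Eliminators.
Variables (X : Type) (e : X -> term).
Hypothesis ve : forall x, is_value (e x).

Lemma steps_bool b s t : is_value s -> is_value t ->
  steps (app (app (enc_bool b) s) t) 2 (if b then s else t).
Proof.
move=> vs vt; have := @steps_beta2 (var (if b then 1 else 0)) s t vs vt.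
by case: b => //=; rewrite subst_value.
Qed.

Lemma steps_pair a b f : is_value a -> is_value b -> is_value f ->
  steps (app (enc_pair a b) f) 1 (app (app f a) b).
Proof.
move=> va vb vf.
have := @steps_beta (app (app (var 0) a) b) f vf.
by rewrite /= !subst_value.
Qed.

Lemma steps_zero s t : is_value s -> is_value t ->
  steps (app (app (enc_nat 0) s) t) 2 s.
Proof. exact: (@steps_bool true). Qed.

Lemma steps_succ n s t : is_value s -> is_value t ->
  steps (app (app (enc_nat n.+1) s) t) 2 (app t (enc_nat n)).
Proof.
move=> vs vt /=; move: (value_nat n); move: (enc_nat n) => m vm.
have := @steps_beta2 (app (var 0) m) s t vs vt.
by rewrite /= !subst_value.
Qed.

Lemma steps_nil s t : is_value s -> is_value t ->
  steps (app (app (enc_list e [::]) s) t) 2 s.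
Proof. exact: (@steps_bool true). Qed.

Lemma steps_cons x l s t : is_value s -> is_value t ->
  steps (app (app (enc_list e (x :: l)) s) t) 2 (app (app t (e x)) (enc_list e l)).
Proof.
move=> vs vt /=; move: (value_list l ve); move: (enc_list e l) => m vm.
have := @steps_beta2 (app (app (var 0) (e x)) m) s t vs vt.
by rewrite /= !subst_value.
Qed.

Lemma steps_none s t : is_value s -> is_value t ->
  steps (app (app (enc_option e None) s) t) 2 t.
Proof. exact: (@steps_bool false). Qed.

Lemma steps_some x s t : is_value s -> is_value t ->
  steps (app (app (enc_option e (Some x)) s) t) 2 (app s (e x)).
Proof.
move=> vs vt; have := @steps_beta2 (app (var 1) (e x)) s t vs vt.
by rewrite /= !subst_value.
Qed.

End Eliminators.

Definition Nil : term := lam (lam (var 1)).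
Definition Cons : term := program (fn x l n c => c $ x $ l).
Definition Pair : term := program (fn a b f => f $ a $ b).
Definition Succ : term := program (fn n z s => s $ n).

Lemma value_Cons : is_value Cons. Proof. by []. Qed.
Lemma value_Pair : is_value Pair. Proof. by []. Qed.
Lemma value_Succ : is_value Succ. Proof. by []. Qed.
#[export] Hint Resolve value_Cons value_Pair value_Succ : val.

Lemma NilE X (e : X -> term) : Nil = enc_list e [::]. Proof. by []. Qed.

Lemma cons_runs X (e : X -> term) x l : (forall x, is_value (e x)) ->
  runs (app (app Cons (e x)) (enc_list e l)) 2 (enc_list e (x :: l)).
Proof.
move=> ve; move: (value_list l ve) (value_list (x :: l) ve) => /=.
move: (enc_list e l) => m vm vxm; finish; first unfold_program Cons; first betas.
  exact: runs_value.
by [].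
Qed.

Lemma pair_runs a b : is_value a -> is_value b ->
  runs (app (app Pair a) b) 2 (enc_pair a b).
Proof.
move=> va vb; finish; first unfold_program Pair; first betas.
  by apply: runs_value; apply: value_pair.
by [].
Qed.

Lemma succ_runs n : runs (app Succ (enc_nat n)) 1 (enc_nat n.+1).
Proof.
move: (value_nat n) (value_nat n.+1) => /=; move: (enc_nat n) => m vm vSm.
finish; first unfold_program Succ; first betas.
  exact: runs_value.
by [].
Qed.

Lemma enc_list_map T U (e : U -> term) (f : T -> U) l :
  enc_list e (map f l) = enc_list (fun x => e (f x)) l.
Proof. by elim: l => //= x l ->. Qed.

Lemma eq_enc_list T (e e' : T -> term) l :
  (forall x, e x = e' x) -> enc_list e l = enc_list e' l.
Proof. by move=> eq_e; elim: l => //= x l ->; rewrite eq_e. Qed.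

Lemma enc_noneE T U (e : T -> term) (e' : U -> term) :
  enc_option e None = enc_option e' None.
Proof. by []. Qed.

Lemma enc_eltE (T : finType) (x : T) : enc_elt x = enc_nat (enum_rank x).
Proof. by []. Qed.

Lemma tsize_list T (e : T -> term) l :
  tsize (enc_list e l) = \sum_(x <- l) (tsize (e x) + 5) + 4.
Proof.
elim: l => [|x l IHl] /=; first by rewrite big_nil.
by rewrite big_cons IHl; lia.
Qed.

Lemma tsize_nat n : tsize (enc_nat n) = 4 * n + 4.
Proof. by elim: n => //= n ->; lia. Qed.

Lemma tsize_bool b : tsize (enc_bool b) <= 4.
Proof. by case: b. Qed.

Lemma tsize_pair a b : tsize (enc_pair a b) = tsize a + tsize b + 4.
Proof. by rewrite /=; lia. Qed.

Lemma tsize_none T (e : T -> term) : tsize (enc_option e None) = 3.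
Proof. by []. Qed.

(* From here on encodings are atoms: [simpl] does not open them, and substitutions into them vanish
   because they are closed. *)
#[global] Opaque Nil Cons Pair Succ enc_nat enc_bool enc_pair enc_list enc_option enc_elt.

Definition Not : term := program (fn b => b $ enc_bool false $ enc_bool true).

Lemma value_Not : is_value Not. Proof. by value_tac. Qed.
#[export] Hint Resolve value_Not : val.

Lemma not_runs b : runs (app Not (enc_bool b)) 3 (enc_bool (~~ b)).
Proof.
finish; first unfold_program Not; first betas.
  step steps_bool; [value_tac.. | by case: b; ret].
by [].
Qed.
#[global] Opaque Not.

(** Recursion by self-application: [r] receives the body itself. The recursive call sits under the
    binders [x xs], so call-by-value reaches it only when the list is a cons. *)
Definition Foldr_body : term := program
  (fn r f a l => l $ a $ (fn x xs => f $ x $ (r $ r $ f $ a $ xs))).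
Definition Foldr : term := program
  (fn f a l => Foldr_body $ Foldr_body $ f $ a $ l).

Lemma value_Foldr : is_value Foldr. Proof. by []. Qed.

(** The constants here and in later costs are generous roundings of numbers of beta-steps; one pass
    of the fold takes 8 besides the call of [f]. Only polynomial growth matters in the end. *)
Definition T_fold (N K : nat) := N * (K + 12) + 12.

(** * Folds and list programs *)

Lemma steps_Foldr_body f a l : is_value f -> is_value a -> is_value l ->
  steps (app (app (app (app Foldr_body Foldr_body) f) a) l) 4
    (app (app l a) (program (fn x xs =>
       f $ x $ (Foldr_body $ Foldr_body $ f $ a $ xs)))).
Proof.
move=> vf va vl K v r; have vB : is_value Foldr_body by [].
finish.
  rewrite {1}/Foldr_body.
  (* Only the head copy is unfolded; the copy passed as an argument becomes the abstract value [B],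
     which the substitution lemmas treat as an atom. *)
  set B := Foldr_body in vB r *; cbv [program hlam happ hcst Nat.sub]; clearbody B.
  by betas; exact: r.
by [].
Qed.
Lemma value_Foldr_body : is_value Foldr_body. Proof. by []. Qed.
#[global] Opaque Foldr_body.

Section Foldr.
Variables (X : eqType) (Y : Type) (eX : X -> term) (eY : Y -> term).
Hypotheses (veX : forall x, is_value (eX x)) (veY : forall y, is_value (eY y)).

(** The cost of [f] is required only at the accumulators that really occur, the folds of suffixes of
    [l]. This matters when the accumulator grows, as in [Subsets], or when its size is bounded
    through its meaning, as in [Best] and [Main]. *)
Lemma foldr_runs_suffix f g y0 l K N :
  is_value f -> size l <= N ->
  (forall l1 x l2, l = l1 ++ x :: l2 ->
     runs (app (app f (eX x)) (eY (foldr g y0 l2))) K (eY (g x (foldr g y0 l2)))) ->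
  runs (app (app (app Foldr f) (eY y0)) (enc_list eX l)) (T_fold N K)
       (eY (foldr g y0 l)).
Proof.
move=> vf leN fP; rewrite /T_fold.
have vB := value_Foldr_body.
have r :
  runs (app (app (app (app Foldr_body Foldr_body) f) (eY y0)) (enc_list eX l))
    (size l * (K + 12) + 6) (eY (foldr g y0 l)).
  elim: l fP {leN} => [|x l IHl] fP.
    finish.
      step steps_Foldr_body; [value_tac.. | cbv [program hlam happ hcst Nat.sub]].
      by step steps_nil; [value_tac.. | ret].
    by [].
  have IHr := IHl (fun l1 x' l2 eq_l => fP (x :: l1) x' l2 (f_equal (cons x) eq_l)).
  finish.
    step steps_Foldr_body; [value_tac.. | cbv [program hlam happ hcst Nat.sub]].
    step steps_cons; [value_tac.. | betas].
    step (steps_runs IHr).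
    exact: fP [::] _ _ (erefl _).
  by rewrite /=; lia.
finish.
  unfold_program Foldr; betas.
  exact: r.
nia.
Qed.

Lemma foldr_runs f g y0 l K N :
  is_value f -> size l <= N ->
  (forall x y, x \in l -> runs (app (app f (eX x)) (eY y)) K (eY (g x y))) ->
  runs (app (app (app Foldr f) (eY y0)) (enc_list eX l)) (T_fold N K)
       (eY (foldr g y0 l)).
Proof.
move=> vf leN fP; apply: foldr_runs_suffix => // l1 x l2 eq_l.
by apply: fP; rewrite eq_l mem_cat mem_head orbT.
Qed.
End Foldr.
#[global] Opaque Foldr.
#[export] Hint Resolve value_Foldr : val.

Definition Iter_body : term := program
  (fn r f a n => n $ a $ (fn m => f $ (r $ r $ f $ a $ m))).
Definition Iter : term := program
  (fn f a n => Iter_body $ Iter_body $ f $ a $ n).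

Lemma value_Iter : is_value Iter. Proof. by []. Qed.

Lemma steps_Iter_body f a n : is_value f -> is_value a -> is_value n ->
  steps (app (app (app (app Iter_body Iter_body) f) a) n) 4
    (app (app n a) (program (fn m =>
       f $ (Iter_body $ Iter_body $ f $ a $ m)))).
Proof.
move=> vf va vn K v r; have vB : is_value Iter_body by [].
finish.
  rewrite {1}/Iter_body.
  set B := Iter_body in vB r *; cbv [program hlam happ hcst Nat.sub]; clearbody B.
  by betas; exact: r.
by [].
Qed.
Lemma value_Iter_body : is_value Iter_body. Proof. by []. Qed.
#[global] Opaque Iter_body.

Section Iter.
Variables (Y : Type) (eY : Y -> term).
Hypothesis (veY : forall y, is_value (eY y)).

(** The cost may depend on the current iterate. This serves [Exp], whose iterates grow and make each
    multiplication dearer. *)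
Lemma iter_runs_sum f g y0 n (K : Y -> nat) :
  is_value f -> (forall y, runs (app f (eY y)) (K y) (eY (g y))) ->
  runs (app (app (app Iter f) (eY y0)) (enc_nat n))
    (\sum_(i < n) (K (iter i g y0) + 12) + 12) (eY (iter n g y0)).
Proof.
move=> vf fP.
have vB := value_Iter_body.
have r : runs (app (app (app (app Iter_body Iter_body) f) (eY y0)) (enc_nat n))
    (\sum_(i < n) (K (iter i g y0) + 12) + 6) (eY (iter n g y0)).
  elim: n => [|n IHr].
    finish.
      step steps_Iter_body; [value_tac.. | cbv [program hlam happ hcst Nat.sub]].
      step steps_zero; [value_tac.. | ret].
    by rewrite big_ord0.
  finish.
    step steps_Iter_body; [value_tac.. | cbv [program hlam happ hcst Nat.sub]].
    step steps_succ; [value_tac.. | betas].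
    step (steps_runs IHr).
    exact: fP.
  by rewrite big_ord_recr /=; lia.
finish.
  unfold_program Iter; betas.
  exact: r.
by lia.
Qed.

Lemma iter_runs f g y0 n K N :
  is_value f -> n <= N -> (forall y, runs (app f (eY y)) K (eY (g y))) ->
  runs (app (app (app Iter f) (eY y0)) (enc_nat n)) (T_fold N K)
    (eY (iter n g y0)).
Proof.
move=> vf leN fP; apply: runs_leq (iter_runs_sum y0 n vf fP) _.
by rewrite sum_nat_const card_ord /T_fold; nia.
Qed.
End Iter.
#[global] Opaque Iter.
#[export] Hint Resolve value_Iter : val.

Definition Map : term := program
  (fn f l => Foldr $ (fn x acc => Cons $ (f $ x) $ acc) $ Nil $ l).
Definition Filter : term := program
  (fn p l => Foldr $ (fn x acc => (p $ x) $ (Cons $ x $ acc) $ acc) $ Nil $ l).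
Definition All : term := program
  (fn p l => Foldr $ (fn x acc => (p $ x) $ acc $ enc_bool false) $ enc_bool true $ l).
Definition Cat : term := program (fn l1 l2 => Foldr $ Cons $ l2 $ l1).
Definition Flatten : term := program (fn ls => Foldr $ Cat $ Nil $ ls).

Lemma value_Map : is_value Map. Proof. by value_tac. Qed.
Lemma value_Filter : is_value Filter. Proof. by value_tac. Qed.
Lemma value_All : is_value All. Proof. by value_tac. Qed.
Lemma value_Cat : is_value Cat. Proof. by value_tac. Qed.
#[export] Hint Resolve value_Map value_Filter value_All value_Cat : val.
Lemma value_Flatten : is_value Flatten. Proof. by value_tac. Qed.
#[export] Hint Resolve value_Flatten : val.

Definition T_list (N K : nat) := T_fold N (K + 10) + 10.

Section Lists.
Variables (X : eqType) (Y : Type) (eX : X -> term) (eY : Y -> term).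
Hypotheses (veX : forall x, is_value (eX x)) (veY : forall y, is_value (eY y)).

Lemma map_runs f g l K N : is_value f -> size l <= N ->
  (forall x, x \in l -> runs (app f (eX x)) K (eY (g x))) ->
  runs (app (app Map f) (enc_list eX l)) (T_list N K) (enc_list eY (map g l)).
Proof.
move=> vf leN fP; finish.
  unfold_program Map; betas; rewrite ?(NilE eX) ?(NilE eY).
  apply: (@foldr_runs _ _ eX (enc_list eY) _ _ _ (fun x acc => g x :: acc) [::] l
    (K + 10) N) => //; try value_tac; move=> x y xl.
  finish; first betas.
    step (steps_runs (fP _ xl)).
    by apply: cons_runs; value_tac.
  by lia.
by rewrite /T_list; lia.
Qed.

Lemma filter_runs f p l K N : is_value f -> size l <= N ->
  (forall x, x \in l -> runs (app f (eX x)) K (enc_bool (p x))) ->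
  runs (app (app Filter f) (enc_list eX l)) (T_list N K)
    (enc_list eX (filter p l)).
Proof.
move=> vf leN fP; finish.
  unfold_program Filter; betas; rewrite ?(NilE eX) ?(NilE eY).
  apply: (@foldr_runs _ _ eX (enc_list eX) _ _ _
    (fun x acc => if p x then x :: acc else acc) [::] l
    (K + 10) N) => //; try value_tac; move=> x y xl.
  finish; first betas.
    step (steps_runs (fP _ xl)).
    step (steps_runs (@cons_runs _ eX x y veX)).
    step steps_bool; [value_tac.. |].
    by case: (p x); ret.
  by lia.
by rewrite /T_list; lia.
Qed.

Lemma all_runs f p l K N : is_value f -> size l <= N ->
  (forall x, x \in l -> runs (app f (eX x)) K (enc_bool (p x))) ->
  runs (app (app All f) (enc_list eX l)) (T_list N K) (enc_bool (all p l)).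
Proof.
move=> vf leN fP; finish.
  unfold_program All; betas; rewrite ?(NilE eX) ?(NilE eY).
  apply: (@foldr_runs _ _ eX enc_bool _ _ _
    (fun x acc => p x && acc) true l
    (K + 10) N) => //; try value_tac; move=> x y xl.
  finish; first betas.
    step (steps_runs (fP _ xl)).
    step steps_bool; [value_tac.. |].
    by case: (p x); ret.
  by lia.
by rewrite /T_list; lia.
Qed.

Definition T_cat (N : nat) := T_list N 0.

Lemma cat_runs l1 l2 N : size l1 <= N ->
  runs (app (app Cat (enc_list eX l1)) (enc_list eX l2)) (T_cat N)
    (enc_list eX (l1 ++ l2)).
Proof.
move=> leN; finish.
  have -> : l1 ++ l2 = foldr cons l2 l1 by elim: (l1) => //= x l ->.
  unfold_program Cat; betas; rewrite ?(NilE eX) ?(NilE eY).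
  apply: (@foldr_runs _ _ eX (enc_list eX) _ _ _ cons l2 l1
    (0 + 10) N) => //; try value_tac; move=> x y xl.
  by apply: runs_leq (cons_runs _ _ _) _.
by rewrite /T_cat /T_list; lia.
Qed.

Definition T_flatten (N : nat) := T_list N (T_cat N).

End Lists.

Lemma flatten_runs (X : eqType) (eX : X -> term) ls N :
  (forall x, is_value (eX x)) -> size ls <= N -> all (fun l => size l <= N) ls ->
  runs (app Flatten (enc_list (enc_list eX) ls)) (T_flatten N)
    (enc_list eX (flatten ls)).
Proof.
move=> veX leN /allP lesN; finish.
  unfold_program Flatten; betas; rewrite ?(NilE eX) ?(NilE eY).
  apply: (@foldr_runs _ _ (enc_list eX) (enc_list eX) _ _ _ cat [::] ls
    (T_cat N) N) => //; try value_tac; move=> x y xl.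
  by apply: cat_runs => //; apply: lesN.
by rewrite /T_flatten /T_list /T_fold; lia.
Qed.
#[global] Opaque Map Filter All Cat Flatten.

(** * Selection by length, subsets, unary numbers and positions *)

Definition Tail : term := program (fn l => l $ Nil $ (fn x xs => xs)).
Definition Isnil : term := program
  (fn l => l $ enc_bool true $ (fn x xs => enc_bool false)).
(** Lengths are compared by dropping, at a cost governed by the second list alone; [Best] puts its
    accumulator there. *)
Definition Leq : term := program
  (fn l1 l2 => Isnil $ (Foldr $ (fn x acc => Tail $ acc) $ l1 $ l2)).
Definition Best : term := program
  (fn ls => Foldr $ (fn l acc => Leq $ l $ acc $ acc $ l) $ Nil $ ls).
Definition Subsets : term := program
  (fn l => Foldr $ (fn x acc => Cat $ acc $ (Map $ (fn y => Cons $ x $ y) $ acc))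
             $ (Cons $ Nil $ Nil) $ l).
Definition Pred : term := program (fn n => n $ enc_nat 0 $ (fn m => m)).
Definition Iszero : term := program
  (fn n => n $ enc_bool true $ (fn m => enc_bool false)).
Definition Eqn : term := program
  (fn m n => (Iszero $ (Iter $ Pred $ m $ n))
               $ (Iszero $ (Iter $ Pred $ n $ m)) $ enc_bool false).
Definition Nth : term := program
  (fn l i => (Iter $ Tail $ l $ i) $ Nil $ (fn x xs => x)).
Definition Mem : term := program
  (fn x l => Not $ (All $ (fn y => Not $ (Eqn $ x $ y)) $ l)).
Definition Iota : term := program
  (fn l => Foldr $ (fn x acc => Cons $ enc_nat 0 $ (Map $ Succ $ acc)) $ Nil $ l).

Lemma value_Nil : is_value Nil. Proof. exact: (value_list [::] value_nat). Qed.
#[export] Hint Resolve value_Nil : val.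
Lemma value_Tail : is_value Tail. Proof. by value_tac. Qed.
Lemma value_Isnil : is_value Isnil. Proof. by value_tac. Qed.
#[export] Hint Resolve value_Tail value_Isnil : val.
Lemma value_Leq : is_value Leq. Proof. by value_tac. Qed.
#[export] Hint Resolve value_Leq : val.
Lemma value_Best : is_value Best. Proof. by value_tac. Qed.
Lemma value_Subsets : is_value Subsets. Proof. by value_tac. Qed.
Lemma value_Pred : is_value Pred. Proof. by value_tac. Qed.
Lemma value_Iszero : is_value Iszero. Proof. by value_tac. Qed.
#[export] Hint Resolve value_Best value_Subsets value_Pred value_Iszero : val.
Lemma value_Eqn : is_value Eqn. Proof. by value_tac. Qed.
Lemma value_Nth : is_value Nth. Proof. by value_tac. Qed.
#[export] Hint Resolve value_Eqn value_Nth : val.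
Lemma value_Mem : is_value Mem. Proof. by value_tac. Qed.
Lemma value_Iota : is_value Iota. Proof. by value_tac. Qed.
#[export] Hint Resolve value_Mem value_Iota : val.

Definition best (X : eqType) (ls : seq (seq X)) : seq X :=
  foldr (fun l acc => if size l <= size acc then acc else l) [::] ls.

Fixpoint subsets (X : eqType) (l : seq X) : seq (seq X) :=
  if l is x :: l' then subsets l' ++ map (cons x) (subsets l') else [:: [::]].

Lemma size_subsets (X : eqType) (l : seq X) : size (subsets l) = 2 ^ size l.
Proof. by elim: l => //= x l IHl; rewrite size_cat size_map IHl expnS; lia. Qed.

Lemma mem_best (X : eqType) (ls : seq (seq X)) : best ls = [::] \/ best ls \in ls.
Proof.
elim: ls => [|l ls IHls] /=; first by left.
case: ifP => _; last by right; rewrite mem_head.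
by case: IHls => [->|m]; [left | right; rewrite inE m orbT].
Qed.

Lemma size_best (X : eqType) (ls : seq (seq X)) l : l \in ls -> size l <= size (best ls).
Proof.
elim: ls => //= l' ls IHls; rewrite inE => /orP[/eqP<-|/IHls].
  by case: ifP.
by case: ifP => // /negbT; rewrite -ltnNge => lt_s /leq_trans; apply; apply: ltnW.
Qed.

Definition T_leq N := T_fold N 10 + 10.
Definition T_best N := T_list N (T_leq N).
Definition T_subsets N := T_fold N (T_list N 10 + T_cat N + 10) + 10.
Definition T_eqn N := T_fold N 10 + T_fold N 10 + 20.
Definition T_nth N := T_fold N 10 + 10.
Definition T_mem N := T_list N (T_eqn N + 10) + 10.
Definition T_iota N := T_fold N (T_list N 10 + 10) + 10.

Section ListPrograms.
Variables (X : eqType) (eX : X -> term).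
Hypothesis veX : forall x, is_value (eX x).
Local Notation eL := (enc_list eX).

Lemma tail_runs l : runs (app Tail (eL l)) 5 (eL (behead l)).
Proof.
case: l => [|x l].
  finish; first unfold_program Tail; first betas.
    by step steps_nil; [value_tac.. | rewrite -(NilE eX); ret].
  by [].
finish; first unfold_program Tail; first betas.
  by step steps_cons; [value_tac.. | betas; ret].
by [].
Qed.
#[global] Opaque Tail.

Lemma isnil_runs l : runs (app Isnil (eL l)) 5 (enc_bool (nilp l)).
Proof.
case: l => [|x l].
  finish; first unfold_program Isnil; first betas.
    by step steps_nil; [value_tac.. | ret].
  by [].
finish; first unfold_program Isnil; first betas.
  by step steps_cons; [value_tac.. | betas; ret].
by [].
Qed.
#[global] Opaque Isnil.

Lemma foldr_behead (l1 l2 : seq X) : foldr (fun=> behead) l1 l2 = drop (size l2) l1.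
Proof. by elim: l2 => [|x l2 /= ->]; rewrite ?drop0 // -drop1 drop_drop add1n. Qed.

Lemma leq_runs l1 l2 N : size l2 <= N ->
  runs (app (app Leq (eL l1)) (eL l2)) (T_leq N) (enc_bool (size l1 <= size l2)).
Proof.
move=> leN; finish.
  unfold_program Leq; betas.
  call (@foldr_runs _ _ eX eL _ _ _ (fun=> behead) _ _ 10 N).
    move=> x y _; finish; first betas; first exact: tail_runs.
    by [].
  rewrite foldr_behead -subn_eq0 -size_drop.
  exact: isnil_runs.
by rewrite /T_leq; lia.
Qed.
#[global] Opaque Leq.

Lemma best_runs ls N : size ls <= N -> all (fun l => size l <= N) ls ->
  runs (app Best (enc_list eL ls)) (T_best N) (eL (best ls)).
Proof.
move=> leN lesN; finish.
  unfold_program Best; betas; rewrite (NilE eX).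
  apply: (@foldr_runs_suffix _ _ eL eL _ _ _
    (fun l acc => if size l <= size acc then acc else l) _ _ (T_leq N + 10) N) => //;
    try value_tac.
  move=> ls1 x ls2 eq_ls; rewrite -/(best ls2).
  have ley : size (best ls2) <= N.
    have [->//|m] := mem_best ls2.
    by apply: (allP lesN); rewrite eq_ls mem_cat inE m !orbT.
  finish; first betas.
    step (steps_runs (leq_runs x ley)).
    by step steps_bool; [value_tac.. | case: ifP => _; ret].
  by lia.
by rewrite /T_best /T_list; lia.
Qed.
#[global] Opaque Best.

Lemma subsets_runs l N : size l <= N -> 2 ^ size l <= N ->
  runs (app Subsets (eL l)) (T_subsets N) (enc_list eL (subsets l)).
Proof.
move=> leN le2N; finish.
  unfold_program Subsets; betas.
  have -> : app (app Cons Nil) Nil = app (app Cons (eL [::])) (enc_list eL [::]) by [].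
  call (@cons_runs _ eL [::] [::] _).
  pose g x (acc : seq (seq X)) := acc ++ map (cons x) acc.
  have subE l' : foldr g [:: [::]] l' = subsets l' by elim: l' => //= x l' ->.
  rewrite -subE.
  apply: (@foldr_runs_suffix _ _ eX (enc_list eL) _ _ _ g _ _
    (T_list N 10 + T_cat N + 10) N) => //; try value_tac.
  move=> l1 x l2 eq_l; rewrite subE /g.
  have leS : size (subsets l2) <= N.
    apply: leq_trans le2N; rewrite size_subsets leq_pexp2l // eq_l size_cat /=.
    by lia.
  finish; first betas.
    call (@map_runs _ _ eL eL _ _ _ (cons x) _ 10 N).
      move=> y _; finish; first betas; first by apply: cons_runs; value_tac.
      by [].
    by apply: (cat_runs _ _ leS); value_tac.
  by lia.
by rewrite /T_subsets; lia.
Qed.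
#[global] Opaque Subsets.

Lemma nth_runs x0 l i N : i < size l -> size l <= N ->
  runs (app (app Nth (eL l)) (enc_nat i)) (T_nth N) (eX (nth x0 l i)).
Proof.
move=> lt_i leN; finish.
  unfold_program Nth; betas.
  call (@iter_runs _ eL _ _ behead _ _ 10 N).
      exact: leq_trans (ltnW lt_i) leN.
    by move=> y; apply: runs_leq (tail_runs y) _.
  have -> : iter i behead l = drop i l.
    by elim: (i) => [|j /= ->]; rewrite ?drop0 // -drop1 drop_drop add1n.
  rewrite (drop_nth x0 lt_i).
  by step steps_cons; [value_tac.. | betas; ret].
by rewrite /T_nth; lia.
Qed.
#[global] Opaque Nth.

Lemma iota_runs l N : size l <= N ->
  runs (app Iota (eL l)) (T_iota N) (enc_list enc_nat (iota 0 (size l))).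
Proof.
move=> leN; finish.
  unfold_program Iota; betas; rewrite (NilE enc_nat).
  pose g (x : X) acc := 0 :: map S acc.
  have iotaE l' : foldr g [::] l' = iota 0 (size l').
    by elim: l' => //= x l' ->; rewrite /g -(iotaDl 1).
  rewrite -iotaE.
  apply: (@foldr_runs_suffix _ _ eX (enc_list enc_nat) _ _ _ g _ _
    (T_list N 10 + 10) N) => //; try value_tac.
  move=> l1 x l2 eq_l; rewrite iotaE /g.
  finish; first betas.
    call (@map_runs _ _ enc_nat enc_nat _ _ _ S _ 10 N).
        by rewrite size_iota; apply: leq_trans leN; rewrite eq_l size_cat /=; lia.
      by move=> y _; apply: runs_leq (succ_runs y) _.
    by apply: cons_runs; value_tac.
  by lia.
by rewrite /T_iota; lia.
Qed.
#[global] Opaque Iota.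
End ListPrograms.

Lemma pred_runs n : runs (app Pred (enc_nat n)) 5 (enc_nat n.-1).
Proof.
case: n => [|n].
  finish; first unfold_program Pred; first betas.
    by step steps_zero; [value_tac.. | ret].
  by [].
finish; first unfold_program Pred; first betas.
  by step steps_succ; [value_tac.. | betas; ret].
by [].
Qed.
#[global] Opaque Pred.

Lemma iszero_runs n : runs (app Iszero (enc_nat n)) 5 (enc_bool (n == 0)).
Proof.
case: n => [|n].
  finish; first unfold_program Iszero; first betas.
    by step steps_zero; [value_tac.. | ret].
  by [].
finish; first unfold_program Iszero; first betas.
  by step steps_succ; [value_tac.. | betas; ret].
by [].
Qed.
#[global] Opaque Iszero.

Lemma eqn_runs m n N : m <= N -> n <= N ->
  runs (app (app Eqn (enc_nat m)) (enc_nat n)) (T_eqn N) (enc_bool (m == n)).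
Proof.
have subE k l : iter l predn k = k - l.
  by elim: l => [|l /= ->]; rewrite ?subn0 // subnS.
have sub_runs k l : l <= N ->
  runs (app (app (app Iter Pred) (enc_nat k)) (enc_nat l)) (T_fold N 10)
       (enc_nat (k - l)).
  move=> leN; rewrite -subE; apply: iter_runs => //; try value_tac.
  by move=> y; apply: runs_leq (pred_runs y) _.
move=> lemN lenN; finish.
  unfold_program Eqn; betas.
  step (steps_runs (sub_runs m n lenN)); step (steps_runs (sub_runs n m lemN)).
  step (steps_runs (iszero_runs (n - m))); step (steps_runs (iszero_runs (m - n))).
  step steps_bool; [value_tac.. |].
  rewrite !subn_eq0 eqn_leq; case: (m <= n); by ret.
by rewrite /T_eqn; lia.
Qed.
#[global] Opaque Eqn.

Section EltPrograms.
Variables (T : finType) (N : nat).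
Hypothesis leTN : #|T| <= N.

Lemma leq_enum_rank (x : T) : enum_rank x <= N.
Proof. exact: leq_trans (ltnW (ltn_ord _)) leTN. Qed.

Lemma eq_elt_runs (x y : T) :
  runs (app (app Eqn (enc_elt x)) (enc_elt y)) (T_eqn N) (enc_bool (x == y)).
Proof.
rewrite !enc_eltE -(inj_eq enum_rank_inj).
by apply: eqn_runs; apply: leq_enum_rank.
Qed.

Lemma mem_runs (x : T) l : size l <= N ->
  runs (app (app Mem (enc_elt x)) (enc_list (@enc_elt T) l)) (T_mem N)
    (enc_bool (x \in l)).
Proof.
move=> leN; finish.
  unfold_program Mem; betas.
  call (@all_runs _ (@enc_elt T) _ _ (fun y => x != y) _ (T_eqn N + 10) N).
    move=> y _; finish; first betas.
      by step (steps_runs (eq_elt_runs x y)); apply: not_runs.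
    by lia.
  have <- : ~~ all (fun y => x != y) l = (x \in l).
    by rewrite -has_predC -has_pred1; apply: eq_has => y /=; rewrite negbK eq_sym.
  exact: not_runs.
by rewrite /T_mem; lia.
Qed.
#[global] Opaque Mem.

Lemma enc_enum : enc_list enc_nat (iota 0 #|T|) = enc_list (@enc_elt T) (enum T).
Proof.
have -> : iota 0 #|T| = map (fun x : T => val (enum_rank x)) (enum T).
  apply: (@eq_from_nth _ 0) => [|i]; rewrite size_iota; first by rewrite size_map -cardE.
  move=> lt_i; have x0 : T := enum_val (Ordinal lt_i).
  rewrite nth_iota // (nth_map x0) -?cardE // add0n.
  by rewrite -[i]/(val (Ordinal lt_i)) -enum_val_nth enum_valK.
by rewrite enc_list_map.
Qed.

(** Elements are encoded by their rank, so any list of the right length yields the enumeration: the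
    rows of the adjacency matrix for vertices, the list of entries for nodes. *)
Lemma enum_runs (X : eqType) (eX : X -> term) l : (forall x, is_value (eX x)) ->
  size l = #|T| ->
  runs (app Iota (enc_list eX l)) (T_iota N) (enc_list (@enc_elt T) (enum T)).
Proof. by move=> veX szl; rewrite -enc_enum -szl; apply: iota_runs; rewrite // szl. Qed.
End EltPrograms.

(** * Forests and decompositions *)

Section ForestTheory.
Variable F : forest.
Implicit Types (a b r s t : F) (o : option F).

Local Notation up := (obind (@parent F)).

Lemma iter_up_None k : iter k up None = None.
Proof. by elim: k => //= k ->. Qed.

Lemma ancestorP a t :
  reflect (exists k, iter k up (Some t) = Some a) (ancestor a t).
Proof.
apply: (iffP idP) => [|[k]].
  case/connectP=> p; elim: p t => [|s p IHp] t /=; first by move=> _ ->; exists 0.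
  case/andP=> /eqP par_t /IHp{}IHp /IHp[k def_a].
  by exists k.+1; rewrite iterSr /= par_t.
elim: k t => [|k IHk] t; first by case=> ->; apply: connect0.
rewrite iterSr /=; case par_t: (parent t) => [s|]; last by rewrite iter_up_None.
by move/IHk; apply: connect_trans; apply: connect1; rewrite /= par_t.
Qed.

Lemma ancestor_refl t : ancestor t t. Proof. exact: connect0. Qed.

Lemma ancestor_trans a s t : ancestor a s -> ancestor s t -> ancestor a t.
Proof. by move=> as_ st; apply: connect_trans st as_. Qed.

Lemma ancestor_parent s t : parent s = Some t -> ancestor t s.
Proof. by move=> par_s; apply: connect1; rewrite /= par_s. Qed.

Lemma ancestor_cases a s : ancestor a s ->
  a = s \/ exists2 t, parent s = Some t & ancestor a t.
Proof.
case/ancestorP=> -[[->]|k]; first by left.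
rewrite iterSr /=; case par_s: (parent s) => [t|]; last by rewrite iter_up_None.
by right; exists t => //; apply/ancestorP; exists k.
Qed.

(** A cycle of length [k.+1] leads back to [t] after [m * k.+1] steps for every [m], whereas
    [parent_wf] makes every chain stop. *)
Lemma up_acyclic k t : iter k.+1 up (Some t) != Some t.
Proof.
apply/eqP=> cyc; have [m up_m] := parent_wf t.
have cycM j : iter (j * k.+1) up (Some t) = Some t.
  by elim: j => // j IHj; rewrite mulSn iterD IHj.
by have := cycM m; rewrite mulnS addnC iterD up_m iter_up_None.
Qed.

Lemma ancestor_parentN s t : parent s = Some t -> ~~ ancestor s t.
Proof.
move=> par_s; apply/negP=> /ancestorP[k up_k].
by have /eqP[] := up_acyclic k s; rewrite iterSr /= par_s.
Qed.

(** If [s'] were [m.+1] steps above [s], it would be [m] steps above the common parent, hence [m.+1]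
    steps above itself. Comparing parents as options makes two roots siblings too. *)
Lemma siblings_disjoint s s' r : parent s = parent s' ->
  ancestor s r -> ancestor s' r -> s = s'.
Proof.
have lekk s0 s1 k k' : k <= k' -> parent s0 = parent s1 ->
    iter k up (Some r) = Some s0 -> iter k' up (Some r) = Some s1 -> s0 = s1.
  move=> /subnK <- par_s up_k; rewrite iterD up_k.
  case: (k' - k) => [[]//|m]; rewrite iterSr /= par_s => cyc.
  by have /eqP[] := up_acyclic m s1; rewrite iterSr.
move=> par_s /ancestorP[k up_k] /ancestorP[k' up_k'].
have [le_k|/ltnW le_k] := leqP k k'; first exact: (lekk _ _ k k').
by apply/esym; apply: (lekk s' s k' k).
Qed.

Lemma ancestor_comparable a b r :
  ancestor a r -> ancestor b r -> ancestor a b \/ ancestor b a.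
Proof.
have lekk a0 b0 k k' : k <= k' ->
    iter k up (Some r) = Some a0 -> iter k' up (Some r) = Some b0 -> ancestor b0 a0.
  move=> /subnK <- up_k; rewrite iterD up_k => up_b.
  by apply/ancestorP; exists (k' - k).
move=> /ancestorP[k up_k] /ancestorP[k' up_k'].
have [le_k|/ltnW le_k] := leqP k k'; first by right; apply: (lekk _ _ k k').
by left; apply: (lekk b a k' k).
Qed.

Lemma up_card t : exists2 k, k <= #|F| & iter k up (Some t) = None.
Proof.
have [m up_m] := parent_wf t.
have up_c : fconnect up (Some t) None by rewrite -up_m fconnect_iter.
exists (findex up (Some t) None); last exact: iter_findex.
(* The chain lives in [option F], which has one element more than [F]; hence [None] is reached after
   at most [#|F|] steps. *)
rewrite -ltnS -card_option; apply: leq_trans (findex_max up_c) _.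
exact: max_card.
Qed.

Lemma root_above t : exists k s,
  [/\ k < #|F|, iter k up (Some t) = Some s & parent s = None].
Proof.
have [k] := up_card t; elim: k => // k IHk lt_k; rewrite iterS.
case def_s: (iter k up (Some t)) => [s|] /= => [root_s|_]; first by exists k, s.
exact: IHk (ltnW lt_k) def_s.
Qed.

Lemma node_depth_parent s t : parent s = Some t -> node_depth t < node_depth s.
Proof.
move=> par_s; apply: proper_card; apply/properP; split.
  apply/subsetP=> a; rewrite !inE => /andP[anc_a neq_a].
  rewrite (ancestor_trans anc_a (ancestor_parent par_s)).
  apply: contraTneq anc_a => ->; exact: ancestor_parentN.
exists t; rewrite !inE ?eqxx ?andbF // ancestor_parent //=.
by apply/eqP=> eq_ts; have := ancestor_parentN par_s; rewrite eq_ts ancestor_refl.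
Qed.

(** A node of maximal depth is a leaf. It need not lie below [t]: the point is that [depth], a
    maximum over leaves, bounds all nodes, and that a forest with a node has a leaf. *)
Lemma leaf_below t : exists2 l : F, is_leaf l & node_depth t <= node_depth l.
Proof.
case: (@arg_maxnP _ t (fun=> true) (@node_depth F)) => // l _ l_max.
exists l; last exact: l_max.
apply/forallP=> s; apply/eqP=> par_s.
by have := l_max s isT; rewrite /geq /= leqNgt node_depth_parent.
Qed.

Lemma node_depth_leq t : node_depth t <= depth F.
Proof.
have [l leaf_l le_l] := leaf_below t; apply: leq_trans le_l _.
exact: (leq_bigmax_cond _ leaf_l).
Qed.

Lemma leaf_ancestor (l r : F) : is_leaf l -> ancestor l r -> r = l.
Proof.
move=> leaf_l /ancestorP[[[]//|k]].
rewrite iterS; case: (iter k up (Some r)) => //= s /eqP.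
by rewrite (negPf (forallP leaf_l s)).
Qed.

End ForestTheory.

Section GoodDecomposition.
Variables (G : sgraph) (D : decomposition G).

(** Roots are seen as the children of a virtual node [None] with empty bag, so that combining the
    roots at the end is the same operation as combining the children of a node. *)
Definition obag (o : option D) : {set G} := if o is Some t then bag t else set0.

(* A subtree T_s is entered only through its root s and the parent o of s:
   the next two conditions are all that is used of the connectivity axiom. *)
Record good (H : graph_family) : Prop := Good {
  good_cover : forall v : G, exists t : D, v \in bag t;
  good_below : forall (s r r' : D) (v : G), v \notin obag (parent s) ->
    ancestor s r -> v \in bag r -> v \in bag r' -> ancestor s r';
  good_enter : forall (s t r : D) (v : G), parent s = Some t -> v \in bag t ->
    ancestor s r -> v \in bag r -> v \in bag s;
  good_edge : forall u v : G, edge u v -> exists t : D, u \in bag t /\ v \in bag t;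
  good_base : forall (v : G) (s t : D), v \in base D ->
    v \in bag s -> v \in bag t -> s = t;
  good_family : forall t : D, H (induced (bag t :&: base D)) }.

Definition core_list (t : D) : seq G := [seq v <- enum (bag t) | v \notin base D].
Definition base_list (t : D) : seq G := [seq v <- enum (bag t) | v \in base D].
Definition ocore_list (o : option D) : seq G := if o is Some t then core_list t else [::].

Lemma mem_core t v : (v \in core_list t) = (v \in bag t) && (v \notin base D).
Proof. by rewrite mem_filter mem_enum andbC. Qed.

Lemma mem_ocore o v : (v \in ocore_list o) = (v \in obag o) && (v \notin base D).
Proof. by case: o => [t|] /=; rewrite ?mem_core // inE. Qed.

Lemma mem_base t v : (v \in base_list t) = (v \in bag t) && (v \in base D).
Proof. by rewrite mem_filter mem_enum andbC. Qed.

Lemma uniq_core t : uniq (core_list t).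
Proof. exact/filter_uniq/enum_uniq. Qed.

Lemma uniq_base t : uniq (base_list t).
Proof. exact/filter_uniq/enum_uniq. Qed.

Lemma size_core t : size (core_list t) = #|bag t :\: base D|.
Proof.
rewrite -(card_uniqP (uniq_core t)); apply: eq_card => v.
by rewrite mem_core !inE andbC.
Qed.

End GoodDecomposition.

(** * The dynamic program *)

Lemma uniq_flatten_map (I X : eqType) (f : I -> seq X) (l : seq I) :
  uniq l -> {in l, forall i, uniq (f i)} ->
  {in l &, forall i j x, x \in f i -> x \in f j -> i = j} ->
  uniq (flatten (map f l)).
Proof.
elim: l => //= i l IHl /andP[il ul] uf inj_f; rewrite cat_uniq uf ?mem_head //=.
rewrite IHl // => [|j jl|j k jl kl]; first last.
- by apply: inj_f; rewrite inE ?jl ?kl orbT.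
- by apply: uf; rewrite inE jl orbT.
rewrite andbT; apply/hasPn=> x /flatten_mapP[j jl xj]; apply/negP=> xi.
have eq_ij : i = j by apply: inj_f xi xj; rewrite ?mem_head // inE jl orbT.
by rewrite eq_ij jl in il.
Qed.

Lemma filter_subsets (X : eqType) (p : pred X) (l : seq X) : filter p l \in subsets l.
Proof.
elim: l => //= x l IHl; rewrite mem_cat; case: (p x); last by rewrite IHl.
by rewrite map_f ?orbT.
Qed.

Lemma mem_subsets (X : eqType) (l l' : seq X) : l' \in subsets l -> subseq l' l.
Proof.
elim: l l' => [|x l IHl] l' /=; first by rewrite inE => /eqP->.
rewrite mem_cat => /orP[/IHl sl|/mapP[l'' /IHl sl ->]].
  exact: subseq_trans sl (subseq_cons _ _).
by rewrite /= eqxx.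
Qed.

Lemma card_bigcup_leq (I T : finType) (P : pred I) (A : I -> {set T}) :
  #|\bigcup_(i | P i) A i| <= \sum_(i | P i) #|A i|.
Proof.
apply: (big_ind2 (fun (B : {set T}) n => #|B| <= n)) => //; first by rewrite cards0.
move=> B m C n leB leC; rewrite cardsU; apply: leq_trans (leq_subr _ _) _.
exact: leq_add.
Qed.

Section DynamicProgram.
Variables (G : sgraph) (D : decomposition G) (sol : seq G -> seq G).
Implicit Types (X B F : seq G) (s t : D) (o : option D).

Definition nadj X (v : G) : bool := all (fun x => ~~ edge x v) X.

(** [B] is the core of the parent and is decided by [X] alone, so only the rest of a child's entry
    is used. The entry is not asked to agree with [X] on [B]: having no edge to [X] is enough for
    soundness, and for completeness an agreeing entry is among the candidates. *)
Definition pick_table X B (tb : seq (seq G)) : seq G :=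
  best [seq F <- [seq [seq v <- F | v \notin B] | F <- tb] | all (nadj X) F].

Definition kids X B (sts : seq (D * seq (seq G))) : seq G :=
  flatten [seq pick_table X B st.2 | st <- sts].

Definition children o (sts : seq (D * seq (seq G))) :=
  [seq st <- sts | parent st.1 == o].

Definition extend sts t X : seq G :=
  X ++ sol [seq v <- base_list t | nadj X v]
    ++ kids X (core_list t) (children (Some t) sts).

Definition update sts t : seq (seq G) :=
  [seq extend sts t X | X <- subsets (core_list t) & all (nadj X) X].

Definition round (sts : seq (D * seq (seq G))) :=
  [seq (st.1, update sts st.1) | st <- sts].

(** Each round computes all tables from those of the previous round, so [table i t] takes into
    account the nodes fewer than [i] steps below [t], as recorded by [reach]. The initial tables
    have no entry at all; [best] then falls back on [[::]]. *)
Fixpoint table (i : nat) (t : D) : seq (seq G) :=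
  if i is j.+1 then update [seq (s, table j s) | s <- enum D] t else [::].

Definition states i := [seq (t, table i t) | t <- enum D].

Lemma round_states i : round (states i) = states i.+1.
Proof. by rewrite /round -map_comp. Qed.

Definition kids_of i o X : seq G := kids X (ocore_list o) (children o (states i)).

Lemma kids_ofE i o X : kids_of i o X =
  flatten [seq pick_table X (ocore_list o) (table i s) | s <- enum D & parent s == o].
Proof. by rewrite /kids_of /kids /children filter_map -map_comp. Qed.

Lemma tableS i t : table i.+1 t =
  [seq X ++ sol [seq v <- base_list t | nadj X v] ++ kids_of i (Some t) X
  | X <- subsets (core_list t) & all (nadj X) X].
Proof. by []. Qed.

Lemma pick_tableP X B tb : pick_table X B tb = [::] \/
  exists2 F, F \in tb & pick_table X B tb = [seq v <- F | v \notin B] /\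
    all (nadj X) (pick_table X B tb).
Proof.
rewrite /pick_table; set ls := filter _ _; case: (mem_best ls) => [->|]; first by left.
by rewrite {1}mem_filter => /andP[nX /mapP[F Ftb eqF]]; right; exists F; rewrite -?eqF.
Qed.

Variables (H : graph_family) (a : rat).
Hypotheses (gD : good D H) (a_ge0 : (0 <= a)%R) (a_le1 : (a <= 1)%R).
Hypothesis solP : forall t (U : seq G), uniq U -> {subset U <= base_list t} ->
  [/\ uniq (sol U), {subset sol U <= U}, all (nadj (sol U)) (sol U) &
      forall I : {set G}, independent I -> {subset I <= U} ->
        (a * #|I|%:R <= (size (sol U))%:R)%R].

(** * Soundness: the entries of the tables are independent sets *)

Definition below t (v : G) : Prop := exists2 r : D, ancestor t r & v \in bag r.

Definition sound t F : Prop :=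
  [/\ uniq F, {in F, forall v, below t v} & all (nadj F) F].

Lemma nadjP X v : reflect {in X, forall x, ~~ edge x v} (nadj X v).
Proof. exact: allP. Qed.

(** Removing the parent's core removes the whole parent's bag: a base vertex occurs in one bag only,
    and the parent of [s] is not in the subtree of [s]. *)
Lemma below_notin_obag s v :
  below s v -> v \notin ocore_list (parent s) -> v \notin obag (parent s).
Proof.
case=> r anc_r vr; rewrite mem_ocore negb_and negbK => /orP[//|vb].
case par_s: (parent s) => [t|]; rewrite /= ?inE //.
apply/negP=> vt; have eq_rt := good_base gD vb vr vt.
by have := ancestor_parentN par_s; rewrite -eq_rt anc_r.
Qed.

Lemma pick_table_sound i s X : (forall F, F \in table i s -> sound s F) ->
  let K := pick_table X (ocore_list (parent s)) (table i s) in
  [/\ uniq K, {in K, forall v, below s v /\ v \notin obag (parent s)},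
      all (nadj K) K & all (nadj X) K].
Proof.
move=> sndi /=; case: (pick_tableP X (ocore_list (parent s)) (table i s)) => [-> //|].
case=> F /sndi[uF bF nF] [-> nX]; split=> //.
- exact: filter_uniq.
- move=> v; rewrite mem_filter => /andP[vB /bF bv]; split=> //.
  exact: below_notin_obag.
apply/allP=> v; rewrite mem_filter => /andP[_ vF]; apply/nadjP=> x.
by rewrite mem_filter => /andP[_ xF]; apply: (nadjP _ _ (allP nF v vF)).
Qed.

Lemma kids_sound i o X : (forall t F, F \in table i t -> sound t F) ->
  let K := kids_of i o X in
  [/\ uniq K, {in K, forall v, v \notin obag o /\ exists2 s, parent s = o & below s v},
      all (nadj K) K & all (nadj X) K].
Proof.
move=> sndi; rewrite /= kids_ofE.
have pickP s := @pick_table_sound i s X (sndi s).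
have kidP v : v \in flatten [seq pick_table X (ocore_list o) (table i s)
                             | s <- enum D & parent s == o] ->
    exists s, [/\ parent s = o, v \in pick_table X (ocore_list (parent s)) (table i s)
                 & below s v /\ v \notin obag o].
  case/flatten_mapP=> s; rewrite mem_filter => /andP[/eqP par_s _] vs.
  by exists s; rewrite par_s; case: (pickP s); rewrite par_s => _ /(_ v vs).
(* Equal or adjacent vertices share a bag [q]. As neither lies in the parent's bag, [q] is in both
   subtrees, and subtrees of distinct siblings are disjoint. The case of equality gives uniqueness
   of the concatenation, the case of an edge its independence. *)
have sib s s' v w : parent s = o -> parent s' = o -> below s v -> below s' w ->
    v \notin obag o -> w \notin obag o -> v = w \/ edge v w -> s = s'.
  move=> par_s par_s' [r anc_r vr] [r' anc_r' wr'] vo wo vw.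
  have [q [vq wq]] : exists q : D, v \in bag q /\ w \in bag q.
    by case: vw => [eq_vw|/(good_edge gD)//]; exists r; rewrite -eq_vw.
  apply: (@siblings_disjoint _ _ _ q); first by rewrite par_s par_s'.
    by apply: good_below gD _ _ _ _ _ anc_r vr vq; rewrite par_s.
  by apply: good_below gD _ _ _ _ _ anc_r' wr' wq; rewrite par_s'.
split.
- apply: uniq_flatten_map.
  + exact/filter_uniq/enum_uniq.
  + move=> s; rewrite mem_filter => /andP[/eqP par_s _].
    by case: (pickP s); rewrite par_s.
  move=> s s'; rewrite !mem_filter => /andP[/eqP par_s _] /andP[/eqP par_s' _] v vs vs'.
  have [_ /(_ v) + _ _] := pickP s; rewrite par_s => /(_ vs)[bs vo].
  have [_ /(_ v) + _ _] := pickP s'; rewrite par_s' => /(_ vs')[bs' _].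
  by apply: (sib s s' v v) => //; left.
- by move=> v /kidP[s [par_s _ [bv vo]]]; split=> //; exists s.
- apply/allP=> w /kidP[s' [par_s' ws' [bw wo]]]; apply/nadjP=> v.
  move=> /kidP[s [par_s vs [bv vo]]]; apply/negP=> vw.
  have eq_s : s = s' by apply: (sib s s' v w) => //; right.
  rewrite -{}eq_s in ws'; have [_ _ nK _] := pickP s.
  by have := nadjP _ _ (allP nK w ws') v vs; rewrite vw.
by apply/allP=> v /kidP[s [_ vs _]]; have [_ _ _ nX] := pickP s; apply: (allP nX).
Qed.

Lemma table_sound i t F : F \in table i t -> sound t F.
Proof.
elim: i t F => // i IHi t F; rewrite tableS => /mapP[X].
rewrite mem_filter => /andP[nX /mem_subsets sX] ->{F}.
have uX : uniq X := subseq_uniq sX (uniq_core t).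
have XP v : v \in X -> (v \in bag t) && (v \notin base D).
  by move/(mem_subseq sX); rewrite mem_core.
have [uK KP nK nXK] := kids_sound (Some t) X IHi.
set K := kids_of _ _ _ in uK KP nK nXK *.
set U := filter _ _; have uU : uniq U by apply/filter_uniq/uniq_base.
have UP v : v \in U -> [/\ v \in bag t, v \in base D & nadj X v].
  by rewrite mem_filter mem_base => /and3P[].
have [uS sS nS _] := solP uU (fun v vU => mem_subseq (filter_subseq _ _) vU).
set S := sol U in uS sS nS *.
(* The base vertex [v] is in no bag but that of [t], so an edge to [w] would put [w] in the bag of
   [t], where the children contribute nothing. *)
have SK v w : v \in S -> w \in K -> ~~ edge v w.
  move=> /sS/UP[vt vb _] /KP[/= wt _]; apply/negP=> /(good_edge gD)[q [vq wq]].
  by rewrite (good_base gD vb vt vq) wq in wt.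
split.
- rewrite !cat_uniq uX uS uK /= andbT; apply/andP; split.
    rewrite has_cat negb_or; apply/andP; split; apply/hasPn=> v.
      by move=> /sS/UP[_ vb _]; apply/negP=> /XP; rewrite vb andbF.
    by case/KP=> /= vt _; apply/negP=> /XP; rewrite (negPf vt).
  apply/hasPn=> v /KP[/= vt _]; apply/negP=> /sS/UP[vt' _ _].
  by rewrite vt' in vt.
- move=> v; rewrite !mem_cat => /or3P[/XP/andP[vt _]|/sS/UP[vt _ _]|/KP[_ [s par_s]]].
  + by exists t; first exact: ancestor_refl.
  + by exists t; first exact: ancestor_refl.
  case=> r anc_r vr; exists r => //; apply: ancestor_trans anc_r.
  exact: ancestor_parent.
have cross v w : v \in X ++ S ++ K -> w \in X ++ S ++ K -> ~~ edge v w.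
  rewrite !mem_cat.
  have XS x y : x \in X -> y \in S -> ~~ edge x y.
    by move=> xX /sS/UP[_ _ /nadjP]; apply.
  have XK x y : x \in X -> y \in K -> ~~ edge x y.
    by move=> xX /(allP nXK)/nadjP; apply.
  case/or3P=> [vX|vS|vK] /or3P[wX|wS|wK].
  + exact: (nadjP _ _ (allP nX w wX)).
  + exact: XS.
  + exact: XK.
  + by rewrite edge_sym XS.
  + exact: (nadjP _ _ (allP nS w wS)).
  + exact: SK.
  + by rewrite edge_sym XK.
  + by rewrite edge_sym SK.
  exact: (nadjP _ _ (allP nK w wK)).
by apply/allP=> w wF; apply/nadjP=> v vF; apply: cross.
Qed.

(** * Completeness: some entry is nearly as large as any given independent set *)

Fixpoint reach (i : nat) (t : D) : {set G} :=
  if i is j.+1 then bag t :|: \bigcup_(s | parent s == Some t) reach j s else set0.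

Section Completeness.
Variable I : {set G}.
Hypothesis indI : independent I.

Lemma independent_edge x y : x \in I -> y \in I -> ~~ edge x y.
Proof. by move=> xI yI; apply: (forall_inP (forall_inP indI x xI)). Qed.

Definition trace o := [seq v <- ocore_list o | v \in I].

(** The core of [t] is matched exactly and kept out of the count: a core vertex is counted on the
    way from a node to its parent, at the point where it leaves the bags. *)
Definition covers i t F : Prop :=
  {in core_list t, forall v, (v \in F) = (v \in I)} /\
  (a * #|I :&: (reach i t :\: (bag t :\: base D))|%:R <=
   (size [seq v <- F | v \notin core_list t])%:R)%R.

Lemma pick_table_covers i s F : F \in table i s -> covers i s F ->
  (a * #|I :&: (reach i s :\: obag (parent s))|%:R <=
   (size (pick_table (trace (parent s)) (ocore_list (parent s)) (table i s)))%:R)%R.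
Proof.
set o := parent s => FT [FI le_F]; have [uF bF nF] := table_sound FT.
pose F' := [seq v <- F | v \notin ocore_list o].
have vF' v : v \in F -> v \notin core_list s -> v \notin ocore_list o.
  move=> /bF[r anc_r vr] vs; apply: contra vs; rewrite mem_ocore mem_core.
  move=> /andP[vo ->]; rewrite andbT; move: vo; rewrite /o.
  case par_s: (parent s) => [t|] /=; last by rewrite inE.
  by move=> vt; apply: good_enter gD _ _ _ _ par_s vt anc_r vr.
(* Suppose that an edge joins [x] in the trace of the parent to [v] in [F']. A bag containing both
   lies in the subtree of [s], since [v] is not in the parent's bag. So [x] belongs to the core of
   [s], hence to [F], which agrees with [I] there; but [F] is independent. *)
have F'P : F' \in [seq F <- [seq [seq v <- F | v \notin ocore_list o] | F <- table i s]
                  | all (nadj (trace o)) F].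
  rewrite mem_filter map_f // andbT; apply/allP=> v.
  rewrite mem_filter => /andP[vo vF]; have bv := bF v vF.
  have vo' := below_notin_obag bv vo; case: bv => r anc_r vr.
  apply/nadjP=> x; rewrite mem_filter mem_ocore => /and3P[xI xo xb].
  apply/negP=> xv; have [q [xq vq]] := good_edge gD xv.
  have anc_q := good_below gD vo' anc_r vr vq.
  have xs : x \in core_list s.
    rewrite mem_core xb andbT; move: xo; rewrite /o.
    case par_s: (parent s) => [t|] /=; last by rewrite inE.
    by move=> xt; apply: good_enter gD _ _ _ _ par_s xt anc_q xq.
  have xF : x \in F by rewrite FI.
  by have := nadjP _ _ (allP nF v vF) x xF; rewrite xv.
apply: (@le_trans _ _ (size F')%:R%R); last by rewrite ler_nat size_best.
have -> : size F' = (size [seq v <- F' | v \in core_list s] +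
                     size [seq v <- F | v \notin core_list s])%N.
  rewrite -(count_predC (mem (core_list s)) F') !size_filter; congr addn.
  rewrite count_filter; apply: eq_in_count => v vF /=.
  by apply/andb_idr; apply: vF'.
(* These vertices leave the bags here. [F] contains all of them, so they are counted without loss,
   and [a <= 1] brings them under the common factor. *)
pose J := I :&: ((bag s :\: base D) :\: obag o).
have leJ : (#|J| <= size [seq v <- F' | v \in core_list s])%N.
  rewrite -(card_uniqP (filter_uniq _ (filter_uniq _ uF))) subset_leq_card //.
  apply/subsetP=> v; rewrite !inE => /and4P[vI vo vb vs].
  have vc : v \in core_list s by rewrite mem_core vs.
  by rewrite mem_filter vc mem_filter FI // vI andbT mem_ocore (negPf vo).
have leIJ : (#|I :&: (reach i s :\: obag o)| <=
             #|J| + #|I :&: (reach i s :\: (bag s :\: base D))|)%N.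
  rewrite -[leqRHS]cardsUI; apply: leq_trans (leq_addr _ _).
  apply/subset_leq_card/subsetP=> v; rewrite !inE.
  by case: (v \in I); case: (v \in obag o); case: (v \in bag s); case: (v \in base D);
    case: (v \in reach i s).
apply: (@le_trans _ _ (a * (#|J| + #|I :&: (reach i s :\: (bag s :\: base D))|)%:R)%R).
  by rewrite ler_wpM2l // ler_nat.
rewrite !natrD mulrDr; apply: lerD le_F.
apply: (@le_trans _ _ #|J|%:R%R); last by rewrite ler_nat.
by rewrite ler_piMl // ler0n.
Qed.

Lemma kids_covers i o :
  (forall s, parent s = o -> i = 0 \/ exists2 F, F \in table i s & covers i s F) ->
  (a * (\sum_(s | parent s == o) #|I :&: (reach i s :\: obag o)|)%:R <=
   (size (kids_of i o (trace o)))%:R)%R.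
Proof.
move=> covi; rewrite kids_ofE size_flatten sumnE !big_map big_filter big_enum_cond /=.
rewrite !natr_sum mulr_sumr; apply: ler_sum => s /eqP par_s.
have [->|[F FT cF]] := covi s par_s; first by rewrite /= set0D setI0 cards0 mulr0 ler0n.
by have := pick_table_covers FT cF; rewrite par_s.
Qed.

(** The alternative [i = 0] starts the induction: the children then have empty tables, but [reach 0]
    is empty as well, so they have nothing to cover. *)
Lemma table_covers_step i t :
  (forall s, i = 0 \/ exists2 F, F \in table i s & covers i s F) ->
  exists2 F, F \in table i.+1 t & covers i.+1 t F.
Proof.
move=> covi; set X := trace (Some t).
have XI v : v \in X -> v \in I by rewrite mem_filter => /andP[].
have nX : all (nadj X) X.
  by apply/allP=> v /XI vI; apply/nadjP=> x /XI xI; apply: independent_edge.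
set U := [seq v <- base_list t | nadj X v].
have uU : uniq U by apply/filter_uniq/uniq_base.
have UP v : v \in U = [&& nadj X v, v \in bag t & v \in base D].
  by rewrite mem_filter mem_base.
have [uS sS nS leS] := solP uU (fun v vU => mem_subseq (filter_subseq _ _) vU).
have [uK KP nK nXK] := kids_sound (Some t) X (@table_sound i).
exists (X ++ sol U ++ kids_of i (Some t) X).
  rewrite tableS; apply/mapP; exists X => //.
  by rewrite mem_filter nX filter_subsets.
have notin_core v : v \in sol U ++ kids_of i (Some t) X -> v \notin core_list t.
  rewrite mem_cat mem_core => /orP[/sS|/KP[/= /negPf->] //].
  by rewrite UP => /and3P[_ _ ->]; rewrite andbF.
split.
  move=> v vt; rewrite mem_cat (contraTF (@notin_core v)) ?orbF ?negbK //.
  by rewrite mem_filter vt andbT.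
rewrite filter_cat size_cat [X in (_ <= (X + _)%:R)%R](_ : _ = 0%N); last first.
  apply/eqP; rewrite size_filter -leqn0 leqNgt -has_count; apply/hasPn=> v.
  by rewrite mem_filter negbK => /andP[].
rewrite add0n (all_filterP _); last by apply/allP.
rewrite size_cat natrD.
pose J := I :&: (bag t :&: base D).
have leJ : (a * #|J|%:R <= (size (sol U))%:R)%R.
  apply: leS => [|v].
    apply/forall_inP=> x /setIP[xI _]; apply/forall_inP=> y /setIP[yI _].
    exact: independent_edge.
  rewrite !inE UP => /and3P[vI -> ->]; rewrite !andbT.
  by apply/nadjP=> x /XI xI; apply: independent_edge.
have leK := kids_covers (fun s (_ : parent s = Some t) => covi s).
apply: le_trans (lerD leJ leK); rewrite -mulrDr -natrD ler_wpM2l // ler_nat.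
(* On the side of [I] a union bound is enough, while the sizes of the chosen pieces add up exactly
   in the concatenation. *)
pose W := \bigcup_(s | parent s == Some t) (I :&: (reach i s :\: bag t)).
apply: (@leq_trans #|J :|: W|).
  apply/subset_leq_card/subsetP=> v; rewrite !inE => /and3P[vI + /orP[vt|/bigcupP[s ps vs]]].
    by rewrite vI vt andbT negbK /= => ->.
  have [vt|vt _] := boolP (v \in bag t).
    by rewrite vI andbT negbK /= => ->.
  by apply/orP; right; apply/bigcupP; exists s => //; rewrite !inE vI vt.
rewrite cardsU; apply: leq_trans (leq_subr _ _) _; rewrite leq_add2l.
exact: card_bigcup_leq.
Qed.

Lemma table_covers i t : exists2 F, F \in table i.+1 t & covers i.+1 t F.
Proof.
elim: i t => [|i IHi] t; apply: table_covers_step => s; first by left.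
by right; apply: IHi.
Qed.

Lemma kids_table i o :
  (a * (\sum_(s | parent s == o) #|I :&: (reach i s :\: obag o)|)%:R <=
   (size (kids_of i o (trace o)))%:R)%R.
Proof.
apply: kids_covers => s _; case: i => [|i]; first by left.
by right; apply: table_covers.
Qed.

End Completeness.

Lemma reach_ancestor k r t : iter k (obind (@parent D)) (Some r) = Some t ->
  bag r \subset reach k.+1 t.
Proof.
elim: k t => [|k IHk] t; first by case=> ->; apply: subsetUl.
rewrite iterS; case def_s: (iter k _ _) => [s|] //= par_s.
apply: subset_trans (IHk s def_s) _; rewrite subsetU //; apply/orP; right.
by apply: (bigcup_sup s); first exact/eqP.
Qed.

Lemma reach_leq i j t : i <= j -> reach i t \subset reach j t.
Proof.
elim: i j t => [|i IHi] [|j] t //= le_ij; first exact: sub0set.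
apply: setUS; apply/bigcupsP=> s ps; apply: subset_trans (IHi j s le_ij) _.
exact: (bigcup_sup s).
Qed.

(** At the virtual node the bag is empty, so [[::]] is the only guess; [root_above] shows that
    [#|D|] rounds suffice. *)
Definition answer : seq G := kids_of #|D| None [::].

Lemma answer_correct : [/\ uniq answer, independent [set x in answer] &
  (a * (opt G)%:R <= (size answer)%:R)%R].
Proof.
have [uK _ nK _] := kids_sound None [::] (@table_sound #|D|).
split=> //.
  apply/forall_inP=> x; rewrite inE => xK; apply/forall_inP=> y; rewrite inE => yK.
  exact: (nadjP _ _ (allP nK y yK)).
rewrite /opt; have [I indI ->] : exists2 I : {set G}, independent I &
    \max_(I : {set G} | independent I) #|I| = #|I|.
  have ind0 : independent (set0 : {set G}) by apply/forall_inP=> x; rewrite inE.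
  have [I indI ->] := eq_bigmax_cond (fun I : {set G} => #|I|)
    (introT card_gt0P (ex_intro _ set0 ind0)).
  by exists I.
apply: le_trans (kids_table indI #|D| None); rewrite ler_wpM2l // ler_nat.
apply: (@leq_trans #|\bigcup_(s : D | parent s == None) (I :&: (reach #|D| s :\: obag None))|).
  apply/subset_leq_card/subsetP=> v vI; have [r vr] := good_cover gD v.
  have [k [s [lt_k up_k root_s]]] := root_above r.
  apply/bigcupP; exists s; first exact/eqP.
  rewrite !inE vI /=; apply: (subsetP (reach_leq s lt_k)).
  exact: (subsetP (reach_ancestor up_k)).
exact: card_bigcup_leq.
Qed.
End DynamicProgram.

(** * Programs on graphs *)

Definition enc_quad (a b c d : term) : term :=
  lam (app (app (app (app (var 0) a) b) c) d).
Definition Quad : term := program (fn a b c d f => f $ a $ b $ c $ d).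

Lemma value_quad a b c d : is_value a -> is_value b -> is_value c -> is_value d ->
  is_value (enc_quad a b c d).
Proof. by move=> va vb vc vd; rewrite /enc_quad; value_tac. Qed.
#[export] Hint Resolve value_quad : val.

Lemma steps_quad a b c d f :
  is_value a -> is_value b -> is_value c -> is_value d -> is_value f ->
  steps (app (enc_quad a b c d) f) 1 (app (app (app (app f a) b) c) d).
Proof.
move=> va vb vc vd vf.
have := @steps_beta (app (app (app (app (var 0) a) b) c) d) f vf.
by rewrite /= !subst_value.
Qed.

Lemma value_Quad : is_value Quad. Proof. by []. Qed.
#[export] Hint Resolve value_Quad : val.

Lemma quad_runs a b c d : is_value a -> is_value b -> is_value c -> is_value d ->
  runs (app (app (app (app Quad a) b) c) d) 4 (enc_quad a b c d).
Proof.
move=> va vb vc vd; finish; first unfold_program Quad; first betas.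
  by apply: runs_value; apply: value_quad.
by [].
Qed.
#[global] Opaque Quad enc_quad.

Definition Adj : term := program (fn M x y => Nth $ (Nth $ M $ x) $ y).
Definition Nadj : term := program
  (fn M X v => All $ (fn x => Not $ (Adj $ M $ x $ v)) $ X).
Definition Subgraph : term := program
  (fn M U => Map $ (fn x => Map $ (fn y => Adj $ M $ x $ y) $ U) $ U).

Lemma value_Adj : is_value Adj. Proof. by value_tac. Qed.
#[export] Hint Resolve value_Adj : val.
Lemma value_Nadj : is_value Nadj. Proof. by value_tac. Qed.
Lemma value_Subgraph : is_value Subgraph. Proof. by value_tac. Qed.
#[export] Hint Resolve value_Nadj value_Subgraph : val.

Lemma value_graph (G : sgraph) : is_value (enc_graph G).
Proof. by rewrite /enc_graph; value_tac. Qed.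
#[export] Hint Resolve value_graph : val.

Lemma map_enc_runs (X : eqType) (eX e : X -> term) f l K N :
  (forall x, is_value (eX x)) -> (forall x, is_value (e x)) ->
  is_value f -> size l <= N ->
  (forall x, x \in l -> runs (app f (eX x)) K (e x)) ->
  runs (app (app Map f) (enc_list eX l)) (T_list N K) (enc_list e l).
Proof.
move=> veX ve vf leN fP; have := map_runs veX ve (g := id) vf leN fP.
by rewrite map_id.
Qed.

Section ListGraph.
Variables (G : sgraph) (U : seq G).

Definition list_edge : rel 'I_(size U) :=
  fun i j => edge (tnth (in_tuple U) i) (tnth (in_tuple U) j).
Lemma list_edge_sym : symmetric list_edge.
Proof. by move=> i j; apply: edge_sym. Qed.
Lemma list_edge_irr : irreflexive list_edge.
Proof. by move=> i; apply: edge_irr. Qed.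

(* The subgraph induced by U, with the vertices numbered by their position. *)
Definition list_graph : sgraph := SGraph list_edge_sym list_edge_irr.

Lemma enc_list_graph : enc_graph list_graph =
  enc_list (fun x => enc_list (fun y => enc_bool (edge x y)) U) U.
Proof.
have E (e : G -> term) :
    enc_list e U = enc_list (fun i : 'I_(size U) => e (tnth (in_tuple U) i)) (enum 'I_(size U)).
  by rewrite -(enc_list_map e (tnth (in_tuple U))) map_tnth_enum.
by rewrite E; apply: eq_enc_list => i; rewrite E.
Qed.
End ListGraph.

Definition T_adj N := T_nth N + T_nth N + 10.
Definition T_nadj N := T_list N (T_adj N + 10) + 10.
Definition T_subgraph N := T_list N (T_list N (T_adj N + 10) + 10) + 10.

Section GraphPrograms.
Variables (G : sgraph) (N : nat).
Hypothesis leGN : #|G| <= N.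
Local Notation eV := (@enc_elt G).
Local Notation eL := (enc_list eV).
Local Notation M := (enc_graph G).

Lemma adj_runs (x y : G) :
  runs (app (app (app Adj M) (eV x)) (eV y)) (T_adj N) (enc_bool (edge x y)).
Proof.
have lt_rank (z : G) : enum_rank z < size (enum G) by rewrite -cardE; exact: (ltn_ord (enum_rank z)).
have leN : size (enum G) <= N by rewrite -cardE.
finish; first unfold_program Adj; first betas.
  rewrite !enc_eltE /enc_graph.
  call (@nth_runs _ _ _ x (enum G) (enum_rank x) N); first exact: lt_rank.
  rewrite nth_enum_rank.
  call (@nth_runs _ _ _ x (enum G) (enum_rank y) N); first exact: lt_rank.
  by rewrite nth_enum_rank; ret.
by rewrite /T_adj; lia.
Qed.
#[global] Opaque Adj.

Lemma nadj_runs X (v : G) : size X <= N ->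
  runs (app (app (app Nadj M) (eL X)) (eV v)) (T_nadj N) (enc_bool (nadj X v)).
Proof.
move=> leN; finish; first unfold_program Nadj; first betas.
  apply: (@all_runs _ eV _ _ (fun x => ~~ edge x v) _ (T_adj N + 10) N) => //;
    try value_tac.
  move=> x _; finish; first betas.
    by call (adj_runs x v); apply: not_runs.
  by lia.
by rewrite /T_nadj; lia.
Qed.
#[global] Opaque Nadj.

Lemma subgraph_runs U : size U <= N ->
  runs (app (app Subgraph M) (eL U)) (T_subgraph N) (enc_graph (list_graph U)).
Proof.
move=> leN; rewrite enc_list_graph; finish; first unfold_program Subgraph; first betas.
  apply: (@map_enc_runs _ eV _ _ _ (T_list N (T_adj N + 10) + 10) N) => //;
    try value_tac.
  move=> x _; finish; first betas.
    apply: (@map_enc_runs _ eV _ _ _ (T_adj N + 10) N) => //; try value_tac.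
    move=> y _; finish; first betas; first exact: adj_runs.
    by lia.
  by lia.
by rewrite /T_subgraph; lia.
Qed.
#[global] Opaque Subgraph.

End GraphPrograms.

(** [A] is run on a renumbered graph and answers with positions in [U]; the outer [Map] translates
    them back. *)
Definition Solve (A : term) : term := program
  (fn M e U => Map $ (fn i => Nth $ U $ i) $ (A $ (Subgraph $ M $ U) $ e)).

Lemma value_Solve A : closed_term A -> is_value (Solve A).
Proof. by move=> cA; unfold_program Solve; value_tac. Qed.

Definition T_solve N K := T_subgraph N + K + T_list N (T_nth N + 10) + 10.

Lemma solve_runs A (G : sgraph) U e (s : seq (list_graph U)) K N :
  closed_term A -> is_value e -> #|G| <= N -> size U <= N -> size s <= N ->
  runs (app (app A (enc_graph (list_graph U))) e) K (enc_list (@enc_elt _) s) ->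
  runs (app (app (app (Solve A) (enc_graph G)) e) (enc_list (@enc_elt G) U))
    (T_solve N K) (enc_list (@enc_elt G) (map (tnth (in_tuple U)) s)).
Proof.
move=> cA ve leGN leU les rA; finish; first unfold_program Solve.
  betas; call (@subgraph_runs G N leGN U).
  call rA.
  apply: (@map_runs _ _ (@enc_elt _) (@enc_elt G) _ _ _ _ _ (T_nth N + 10) N) => //;
    try value_tac.
  move=> i _; finish; first betas.
    rewrite enc_eltE enum_rank_ord (tnth_nth (tnth (in_tuple U) i)) /=.
    by apply: (@nth_runs _ _ _ _ _ _ N) => //; value_tac.
  by lia.
by rewrite /T_solve; lia.
Qed.
#[global] Opaque Solve.

Definition Kids : term := program (fn M X B sts =>
  Flatten $ (Map $ (fn st => st $ (fn nd tb =>
    Best $ (Filter $ (fn F => All $ (fn v => Nadj $ M $ X $ v) $ F)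
      $ (Map $ (fn F => Filter $ (fn v => Not $ (Mem $ v $ B)) $ F) $ tb)))) $ sts)).
Definition Children : term := program (fn test sts =>
  Filter $ (fn st => st $ (fn nd tb => nd $ (fn i p B P => test $ p))) $ sts).
(** The redex on [ch] is a let: the children are selected once per node and not once per subset
    [X]. *)
Definition Update (S : term) : term := program (fn M e sts st =>
  st $ (fn nd tb => nd $ (fn i p B P =>
    (fn ch => Pair $ nd $ (Map
       $ (fn X => Cat $ X $ (Cat
            $ (S $ M $ e $ (Filter $ (fn v => Nadj $ M $ X $ v) $ P))
            $ (Kids $ M $ X $ B $ ch)))
       $ (Filter $ (fn X => All $ (fn v => Nadj $ M $ X $ v) $ X) $ (Subsets $ B))))
    $ (Children $ (fn q => q $ (fn j => Eqn $ j $ i) $ enc_bool false) $ sts)))).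
Definition Init : term := program (fn nodes base =>
  Map $ (fn i => (Nth $ nodes $ i) $ (fn p bg =>
    Pair $ (Quad $ i $ p $ (Filter $ (fn v => Not $ (Mem $ v $ base)) $ bg)
                         $ (Filter $ (fn v => Mem $ v $ base) $ bg)) $ Nil))
      $ (Iota $ nodes)).
(** [Foldr] over [nodes] is a for-loop: its elements are ignored, its length is the number of
    rounds. *)
Definition Main (S : term) : term := program (fn M D e =>
  D $ (fn nodes base =>
    Kids $ M $ Nil $ Nil $ (Children $ (fn q => q $ (fn j => enc_bool false) $ enc_bool true)
      $ (Foldr $ (fn x sts => Map $ (fn st => Update S $ M $ e $ sts $ st) $ sts)
           $ (Init $ nodes $ base) $ nodes)))).

Lemma value_Kids : is_value Kids. Proof. by value_tac. Qed.
Lemma value_Children : is_value Children. Proof. by value_tac. Qed.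
Lemma value_Init : is_value Init. Proof. by value_tac. Qed.
#[export] Hint Resolve value_Kids value_Children value_Init : val.
Lemma value_Update S : is_value S -> is_value (Update S).
Proof. by move=> vS; unfold_program Update; value_tac. Qed.
#[export] Hint Resolve value_Update : val.
Lemma value_Main S : is_value S -> is_value (Main S).
Proof. by move=> vS; unfold_program Main; value_tac. Qed.
#[export] Hint Resolve value_Main : val.

(** * The dynamic program in the lambda-calculus *)

Lemma value_set (T : finType) (A : {set T}) : is_value (enc_set A).
Proof. by rewrite /enc_set; value_tac. Qed.
#[export] Hint Resolve value_set : val.

Lemma value_decomposition (G : sgraph) (D : decomposition G) :
  is_value (enc_decomposition D).
Proof. by rewrite /enc_decomposition; value_tac. Qed.
#[export] Hint Resolve value_decomposition : val.

Lemma size_uniq_leq (T : finType) (l : seq T) N : #|T| <= N -> uniq l -> size l <= N.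
Proof. by move=> leN /card_uniqP <-; apply: leq_trans (max_card _) leN. Qed.

Definition T_pick N :=
  T_list N (T_list N (T_mem N + 10) + 10) + T_list N (T_list N (T_nadj N + 10) + 10)
  + T_best N + 20.
Definition T_kids N := T_list N (T_pick N + 10) + T_flatten N + 20.
Definition T_children N := T_list N (T_eqn N + 40) + 10.
Definition T_update N K :=
  T_list N (K + T_list N (T_nadj N + 10) + T_kids N + T_cat N + T_cat N + 20)
  + T_list N (T_list N (T_nadj N + 10) + 10) + T_subsets N + T_children N + 60.
Definition T_init N :=
  T_list N (T_nth N + T_list N (T_mem N + 10) + T_list N (T_mem N + 10) + 40)
  + T_iota N + 20.
Definition T_main N K :=
  T_kids N + T_children N + T_fold N (T_list N (T_update N K + 10) + 10) + T_init N + 40.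

Section MainProgram.
Variables (G : sgraph) (D : decomposition G) (N : nat).
Hypotheses (leGN : #|G| <= N) (leDN : #|D| <= N).
Local Notation eV := (@enc_elt G).
Local Notation eL := (enc_list eV).
Local Notation M := (enc_graph G).

Definition enc_node (t : D) : term :=
  enc_quad (enc_elt t) (enc_option (@enc_elt D) (parent t)) (eL (core_list t))
           (eL (base_list t)).
Definition enc_state (st : D * seq (seq G)) : term :=
  enc_pair (enc_node st.1) (enc_list eL st.2).

Lemma value_node t : is_value (enc_node t).
Proof. by apply: value_quad; value_tac. Qed.
#[local] Hint Resolve value_node : val.

Lemma value_state st : is_value (enc_state st).
Proof. by apply: value_pair; value_tac. Qed.
#[local] Hint Resolve value_state : val.

Lemma enc_nodeE t : enc_node t =
  enc_quad (enc_elt t) (enc_option (@enc_elt D) (parent t)) (eL (core_list t))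
           (eL (base_list t)).
Proof. by []. Qed.

Lemma enc_stateE st : enc_state st = enc_pair (enc_node st.1) (enc_list eL st.2).
Proof. by []. Qed.
#[global] Opaque enc_node enc_state.

Definition bounded (st : D * seq (seq G)) : Prop :=
  size st.2 <= N /\ all (fun F => size F <= N) st.2.

(** The left-hand side is what the body of [Kids] becomes for one child once its arguments have been
    substituted. *)
Lemma pick_table_runs X B tb : size X <= N -> size B <= N -> size tb <= N ->
  all (fun F => size F <= N) tb ->
  runs (app Best (app (app Filter
      (lam (app (app All (lam (app (app (app Nadj M) (eL X)) (var 0)))) (var 0))))
    (app (app Map (lam (app (app Filter
      (lam (app Not (app (app Mem (var 0)) (eL B))))) (var 0)))) (enc_list eL tb))))
    (T_pick N) (eL (pick_table X B tb)).
Proof.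
move=> leX leB leT /allP leF; finish.
  call (@map_runs _ _ eL eL _ _ _ (fun F => [seq v <- F | v \notin B]) _
    (T_list N (T_mem N + 10) + 10) N).
    move=> F FT; finish; first betas.
      apply: (@filter_runs _ eV _ _ (fun v => v \notin B) _ (T_mem N + 10) N);
        [value_tac.. | exact: leF |].
      move=> v _; finish; first betas.
        by call (mem_runs leGN v leB); apply: not_runs.
      by lia.
    by lia.
  call (@filter_runs _ eL _ _ (fun F => all (nadj X) F) _
    (T_list N (T_nadj N + 10) + 10) N).
      by rewrite size_map.
    move=> _ /mapP[F FT ->]; finish; first betas.
      apply: (@all_runs _ eV _ _ (nadj X) _ (T_nadj N + 10) N); [value_tac.. | |].
        rewrite size_filter; apply: leq_trans (count_size _ _) (leF _ FT).
      move=> v _; finish; first betas; first exact: (nadj_runs leGN _ leX).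
      by lia.
    by lia.
  apply: (@best_runs _ eV _ _ N).
  - by value_tac.
  - by rewrite size_filter; apply: leq_trans (count_size _ _) _; rewrite size_map.
  apply/allP=> F; rewrite mem_filter => /andP[_ /mapP[F' FT ->]].
  by rewrite size_filter; apply: leq_trans (count_size _ _) (leF _ FT).
by rewrite /T_pick; lia.
Qed.

Lemma kids_runs X B sts : size X <= N -> size B <= N -> size sts <= N ->
  {in sts, forall st, bounded st} ->
  runs (app (app (app (app Kids M) (eL X)) (eL B)) (enc_list enc_state sts))
    (T_kids N) (eL (kids X B sts)).
Proof.
move=> leX leB leN bst; finish; first unfold_program Kids; first betas.
  call (@map_runs _ _ enc_state eL _ _ _ (fun st => pick_table X B st.2) _
    (T_pick N + 10) N).
    move=> st /bst[leT leF]; finish; first betas.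
      rewrite enc_stateE; step steps_pair; [value_tac.. | betas].
      exact: pick_table_runs.
    by lia.
  apply: (@flatten_runs _ eV _ N); first by value_tac.
    by rewrite size_map.
  apply/allP=> _ /mapP[st /bst[_ /allP leF] ->].
  case: (pick_tableP X B st.2) => [-> //|[F /leF le_F [-> _]]].
  by rewrite size_filter; apply: leq_trans (count_size _ _) le_F.
by rewrite /T_kids; lia.
Qed.
#[global] Opaque Kids.

Lemma children_runs test o sts : is_value test -> size sts <= N ->
  (forall t : D, runs (app test (enc_option (@enc_elt D) (parent t))) (T_eqn N + 20)
                   (enc_bool (parent t == o))) ->
  runs (app (app Children test) (enc_list enc_state sts)) (T_children N)
    (enc_list enc_state (children o sts)).
Proof.
move=> vt leN testP; finish; first unfold_program Children; first betas.
  apply: (@filter_runs _ enc_state _ _ (fun st => parent st.1 == o) _ (T_eqn N + 40) N)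
    => //; try value_tac.
  move=> st _; finish; first betas.
    rewrite enc_stateE; step steps_pair; [value_tac.. | betas].
    rewrite enc_nodeE; step steps_quad; [value_tac.. | betas].
    exact: testP.
  by lia.
by rewrite /T_children; lia.
Qed.
#[global] Opaque Children.

Lemma children_some_runs t sts : size sts <= N ->
  runs (app (app Children
         (lam (app (app (var 0) (lam (app (app Eqn (var 0)) (enc_elt t)))) (enc_bool false))))
       (enc_list enc_state sts)) (T_children N)
    (enc_list enc_state (children (Some t) sts)).
Proof.
move=> leN; apply: children_runs; [value_tac | exact: leN |].
move=> s; case: (parent s) => [j|]; finish.
- betas; step steps_some; [value_tac.. | betas].
  exact: (eq_elt_runs leDN).
- by lia.
- by betas; step steps_none; [value_tac.. | ret].
by lia.
Qed.

Lemma children_none_runs sts : size sts <= N ->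
  runs (app (app Children
         (lam (app (app (var 0) (lam (enc_bool false))) (enc_bool true))))
       (enc_list enc_state sts)) (T_children N)
    (enc_list enc_state (children None sts)).
Proof.
move=> leN; apply: children_runs; [value_tac | exact: leN |].
move=> s; case: (parent s) => [j|]; finish.
- by betas; step steps_some; [value_tac.. | betas; ret].
- by lia.
- by betas; step steps_none; [value_tac.. | ret].
by lia.
Qed.

Variables (S e : term) (sol : seq G -> seq G) (K : nat).
Hypotheses (vS : is_value S) (ve : is_value e).
Hypothesis solP : forall (t : D) U, uniq U -> {subset U <= base_list t} ->
  [/\ runs (app (app (app S M) e) (eL U)) K (eL (sol U)), uniq (sol U)
    & {subset sol U <= U}].
Hypothesis leCN : forall t : D, 2 ^ size (core_list t) <= N.

Lemma update_runs sts t tb : size sts <= N -> {in sts, forall st, bounded st} ->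
  runs (app (app (app (app (Update S) M) e) (enc_list enc_state sts)) (enc_state (t, tb)))
    (T_update N K) (enc_state (t, update sol sts t)).
Proof.
move=> leN bst; have leC : size (core_list t) <= N.
  exact: size_uniq_leq (uniq_core t).
have leX X : X \in subsets (core_list t) -> size X <= N.
  by move=> /mem_subsets/size_subseq/leq_trans; apply.
finish; first unfold_program Update; first betas.
  rewrite (enc_stateE (t, tb)); step steps_pair; [value_tac.. | betas].
  rewrite {1}enc_nodeE; step steps_quad; [value_tac.. | betas].
  call (@children_some_runs t sts leN); betas.
  call (@subsets_runs _ eV _ (core_list t) N); first exact: leCN.
  call (@filter_runs _ eL _ _ (fun X => all (nadj X) X) _
    (T_list N (T_nadj N + 10) + 10) N).
      by rewrite size_subsets.
    move=> X /leX le_X; finish; first betas.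
      apply: (@all_runs _ eV _ _ (nadj X) _ (T_nadj N + 10) N); [value_tac.. | by []|].
      move=> v _; finish; first betas; first exact: (nadj_runs leGN _ le_X).
      by lia.
    by lia.
  call (@map_runs _ _ eL eL _ _ _ (extend sol sts t) _
    (K + T_list N (T_nadj N + 10) + T_kids N + T_cat N + T_cat N + 20) N).
      by rewrite size_filter; apply: leq_trans (count_size _ _) _; rewrite size_subsets.
    move=> X; rewrite mem_filter => /andP[_ /leX le_X].
    set U := [seq v <- base_list t | nadj X v].
    have uU : uniq U by apply/filter_uniq/uniq_base.
    have [rU uS _] := solP uU (fun v vU => mem_subseq (filter_subseq _ _) vU).
    finish; first betas.
      call (@filter_runs _ eV _ _ (nadj X) _ (T_nadj N + 10) N).
          exact: size_uniq_leq (uniq_base t).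
        move=> v _; finish; first betas; first exact: (nadj_runs leGN _ le_X).
        by lia.
      call rU.
      call (@kids_runs X (core_list t) (children (Some t) sts)).
          by rewrite size_filter; apply: leq_trans (count_size _ _) _.
        by move=> st; rewrite mem_filter => /andP[_ /bst].
      call (@cat_runs _ eV _ (sol U) (kids X (core_list t) (children (Some t) sts)) N).
        exact: size_uniq_leq.
      by apply: (@cat_runs _ eV _ X _ N) => //; value_tac.
    by lia.
  by apply: pair_runs; value_tac.
by rewrite /T_update; lia.
Qed.
#[global] Opaque Update.

Definition enc_entry (t : D) : term :=
  enc_pair (enc_option (@enc_elt D) (parent t)) (enc_set (bag t)).

Lemma value_entry t : is_value (enc_entry t).
Proof. by apply: value_pair; value_tac. Qed.
#[local] Hint Resolve value_entry : val.

Lemma init_runs :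
  runs (app (app Init (enc_list enc_entry (enum D))) (enc_set (base D))) (T_init N)
    (enc_list enc_state (states D sol 0)).
Proof.
have leB (A : {set G}) : size (enum A) <= N.
  exact: size_uniq_leq leGN (enum_uniq _).
finish; first unfold_program Init; first betas.
  call (@enum_runs D N leDN _ enc_entry (enum D)); first by rewrite -cardE.
  apply: (@map_runs _ _ (@enc_elt D) enc_state _ _ _ (fun t => (t, [::])) _
    (T_nth N + T_list N (T_mem N + 10) + T_list N (T_mem N + 10) + 40) N);
    try value_tac; first by rewrite -cardE.
  move=> t _; finish; first betas.
    rewrite {1}(enc_eltE t).
    call (@nth_runs _ enc_entry _ t (enum D) (enum_rank t) N).
        by rewrite -cardE; exact: (ltn_ord (enum_rank t)).
      by rewrite -cardE.
    rewrite nth_enum_rank {1}/enc_entry; step steps_pair; [value_tac.. | betas].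
    rewrite /enc_set.
    call (@filter_runs _ eV _ _ (fun v => v \in base D) _ (T_mem N + 10) N).
        exact: leB.
      move=> v _; finish; first betas.
        by rewrite -(mem_enum (base D)); apply: (mem_runs leGN v (leB _)).
      by lia.
    call (@filter_runs _ eV _ _ (fun v => v \notin base D) _ (T_mem N + 10) N).
        exact: leB.
      move=> v _; finish; first betas.
        by call (mem_runs leGN v (leB (base D))); rewrite mem_enum; apply: not_runs.
      by lia.
    call (@quad_runs (enc_elt t) (enc_option (@enc_elt D) (parent t))
            (eL (core_list t)) (eL (base_list t))).
    rewrite -enc_nodeE (NilE eL) enc_stateE.
    by apply: pair_runs; value_tac.
  by lia.
by rewrite /T_init; lia.
Qed.
#[global] Opaque Init.

Hypothesis bounded_table : forall i t, bounded (t, table sol i t).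

Lemma main_runs :
  runs (app (app (app (Main S) M) (enc_decomposition D)) e) (T_main N K)
    (eL (answer D sol)).
Proof.
have leE : size (enum D) <= N by rewrite -cardE.
have bst i : {in states D sol i, forall st, bounded st} by move=> _ /mapP[t _ ->].
have szst i : size (states D sol i) <= N by rewrite size_map.
have statesE (l : seq D) : foldr (fun=> round sol) (states D sol 0) l = states D sol (size l).
  by elim: l => //= t l ->; rewrite round_states.
finish; first unfold_program Main; first betas.
  rewrite /enc_decomposition -/enc_entry; step steps_pair; [value_tac.. | betas].
  call init_runs.
  call (@foldr_runs_suffix _ _ enc_entry (enc_list enc_state) _ _ _
     (fun=> round sol) (states D sol 0) (enum D)
     (T_list N (T_update N K + 10) + 10) N).
    move=> l1 t l2 eqD; rewrite statesE; finish; first betas.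
      apply: (@map_runs _ _ enc_state enc_state _ _ _
        (fun st => (st.1, update sol (states D sol (size l2)) st.1)) _
        (T_update N K + 10) N); try value_tac; first exact: szst.
      move=> [s tb] _; finish; first betas; first by apply: update_runs; [exact: szst | exact: bst].
      by lia.
    by lia.
  rewrite statesE -cardE.
  call (@children_none_runs (states D sol #|D|) (szst _)).
  rewrite (NilE eV).
  apply: kids_runs => //.
    by rewrite size_filter; apply: leq_trans (count_size _ _) _.
  by move=> st; rewrite mem_filter => /andP[_ /bst].
by rewrite /T_main; lia.
Qed.
End MainProgram.
#[global] Opaque Main.

(** * Polynomial bounds and arithmetic *)

Lemma leq_expl m n e : m <= n -> m ^ e <= n ^ e.
Proof. by case: e => // e le_mn; rewrite leq_exp2r. Qed.

(** The base [n.+2] is at least 2 even at 0, so constants and sums are absorbed by the exponent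
    without side conditions. *)
Definition poly (T : nat -> nat) : Prop := exists c, forall n, T n <= n.+2 ^ c.

Lemma poly_const m : poly (fun=> m).
Proof.
by exists m => n; apply: leq_trans (ltnW (ltn_expl m (ltnSn 1))) (leq_expl _ _).
Qed.

Lemma poly_id : poly (fun n => n).
Proof. by exists 1 => n; rewrite expn1; lia. Qed.

Lemma poly_add f g : poly f -> poly g -> poly (fun n => f n + g n).
Proof.
(* The extra factor is at least 2, and [z + w <= 2 * z * w] for positive [z] and [w]. *)
move=> [c fP] [d gP]; exists (c + d).+1 => n; rewrite expnS expnD.
have := fP n; have := gP n; move: (f n) (g n) => x y.
have : 0 < n.+2 ^ c by rewrite expn_gt0.
have : 0 < n.+2 ^ d by rewrite expn_gt0.
move: (n.+2 ^ c) (n.+2 ^ d) => z w; nia.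
Qed.

Lemma poly_mul f g : poly f -> poly g -> poly (fun n => f n * g n).
Proof. by move=> [c fP] [d gP]; exists (c + d) => n; rewrite expnD leq_mul. Qed.

Lemma poly_exp f c : poly f -> poly (fun n => f n ^ c).
Proof. by move=> [d fP]; exists (d * c) => n; rewrite expnM leq_expl. Qed.

Lemma poly_comp f g : poly f -> poly g -> poly (fun n => f (g n)).
Proof.
move=> [c fP] /poly_add/(_ (poly_const 2))[d gP]; exists (d * c) => n.
rewrite expnM; apply: leq_trans (fP _) (leq_expl _ _).
by rewrite -addn2.
Qed.

Lemma poly_leq T : poly T -> exists c, forall n, 1 < n -> T n <= n ^ c.
Proof.
(* For [n] at least 2, [n.+2 <= n ^ 2]. *)
move=> [c TP]; exists (2 * c) => n n_gt1; apply: leq_trans (TP n) _.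
by rewrite expnM leq_expl // expnS expn1; nia.
Qed.

Create HintDb poly.

Lemma poly_fold f g : poly f -> poly g -> poly (fun n => T_fold (f n) (g n)).
Proof.
move=> pf pg; rewrite /T_fold; apply: poly_add (poly_const _).
exact: poly_mul pf (poly_add pg (poly_const _)).
Qed.

Lemma poly_list f g : poly f -> poly g -> poly (fun n => T_list (f n) (g n)).
Proof.
move=> pf pg; apply: poly_add (poly_const _).
exact: poly_fold pf (poly_add pg (poly_const _)).
Qed.

Ltac poly_cost :=
  lazymatch goal with
  | |- poly (fun n => @?f n + @?g n) => apply: (@poly_add f g); poly_cost
  | |- poly (fun n => @?f n * @?g n) => apply: (@poly_mul f g); poly_cost
  | |- poly (fun n => @?f n ^ ?c) => apply: (@poly_exp f c); poly_cost
  | |- poly (fun n => T_fold (@?f n) (@?g n)) => apply: (@poly_fold f g); poly_cost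
  | |- poly (fun n => T_list (@?f n) (@?g n)) => apply: (@poly_list f g); poly_cost
  | |- poly (fun n => n) => apply: poly_id
  | |- _ => first [ assumption | apply: poly_const | solve [auto with poly] ]
  end.

Lemma poly_eqn : poly T_eqn. Proof. by rewrite /T_eqn; poly_cost. Qed.
Lemma poly_nth : poly T_nth. Proof. by rewrite /T_nth; poly_cost. Qed.
Lemma poly_cat : poly T_cat. Proof. by rewrite /T_cat; poly_cost. Qed.
Lemma poly_leqsize : poly T_leq. Proof. by rewrite /T_leq; poly_cost. Qed.
Lemma poly_iota : poly T_iota. Proof. by rewrite /T_iota; poly_cost. Qed.
#[export] Hint Resolve poly_eqn poly_nth poly_cat poly_leqsize poly_iota : poly.
Lemma poly_mem : poly T_mem. Proof. by rewrite /T_mem; poly_cost. Qed.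
Lemma poly_flatten : poly T_flatten. Proof. by rewrite /T_flatten; poly_cost. Qed.
Lemma poly_best : poly T_best. Proof. by rewrite /T_best; poly_cost. Qed.
Lemma poly_subsets : poly T_subsets. Proof. by rewrite /T_subsets; poly_cost. Qed.
Lemma poly_adj : poly T_adj. Proof. by rewrite /T_adj; poly_cost. Qed.
#[export] Hint Resolve poly_mem poly_flatten poly_best poly_subsets poly_adj : poly.
Lemma poly_nadj : poly T_nadj. Proof. by rewrite /T_nadj; poly_cost. Qed.
Lemma poly_subgraph : poly T_subgraph. Proof. by rewrite /T_subgraph; poly_cost. Qed.
Lemma poly_init : poly T_init. Proof. by rewrite /T_init; poly_cost. Qed.
Lemma poly_children : poly T_children. Proof. by rewrite /T_children; poly_cost. Qed.
#[export] Hint Resolve poly_nadj poly_subgraph poly_init poly_children : poly.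
Lemma poly_pick : poly T_pick. Proof. by rewrite /T_pick; poly_cost. Qed.
#[export] Hint Resolve poly_pick : poly.
Lemma poly_kids : poly T_kids. Proof. by rewrite /T_kids; poly_cost. Qed.
#[export] Hint Resolve poly_kids : poly.

Lemma poly_solve f : poly f -> poly (fun n => T_solve n (f n)).
Proof. by move=> pf; rewrite /T_solve; poly_cost. Qed.

Lemma poly_main f : poly f -> poly (fun n => T_main n (f n)).
Proof. by move=> pf; rewrite /T_main /T_update; poly_cost. Qed.

(** * Unary arithmetic, for the term that computes the bound [f] *)

Definition Add : term := program (fn m n => Iter $ Succ $ n $ m).
Definition Mul : term := program (fn m n => Iter $ (fn x => Add $ m $ x) $ enc_nat 0 $ n).
Definition Exp : term := program (fn m n => Iter $ (fn x => Mul $ m $ x) $ enc_nat 1 $ n).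

Lemma value_Add : is_value Add. Proof. by value_tac. Qed.
#[export] Hint Resolve value_Add : val.
Lemma value_Mul : is_value Mul. Proof. by value_tac. Qed.
#[export] Hint Resolve value_Mul : val.
Lemma value_Exp : is_value Exp. Proof. by value_tac. Qed.
#[export] Hint Resolve value_Exp : val.

Lemma add_runs m n :
  runs (app (app Add (enc_nat m)) (enc_nat n)) (T_fold m 1 + 2) (enc_nat (m + n)).
Proof.
finish; first unfold_program Add; first betas.
  have -> : m + n = iter m S n by elim: m => //= m <-.
  apply: (@iter_runs _ enc_nat _ _ _ _ _ 1 m) => //; try value_tac.
  exact: succ_runs.
by lia.
Qed.
#[global] Opaque Add.

Lemma mul_runs m n :
  runs (app (app Mul (enc_nat m)) (enc_nat n)) (T_fold n (T_fold m 1 + 3) + 2)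
    (enc_nat (m * n)).
Proof.
finish; first unfold_program Mul; first betas.
  have -> : m * n = iter n (addn m) 0 by rewrite iter_addn_0.
  apply: (@iter_runs _ enc_nat _ _ _ _ _ (T_fold m 1 + 3) n) => //; try value_tac.
  move=> x; finish; first betas; first exact: add_runs.
  by lia.
by lia.
Qed.
#[global] Opaque Mul.

(** No explicit cost: [computable_bound] only asks the term to end with the right value. *)
Lemma exp_runs m n : exists K,
  runs (app (app Exp (enc_nat m)) (enc_nat n)) K (enc_nat (m ^ n)).
Proof.
eexists; unfold_program Exp; betas.
have -> : m ^ n = iter n (muln m) 1 by elim: n => // n; rewrite expnS => ->.
apply: (@iter_runs_sum _ enc_nat _ _ _ _ _ (fun x => T_fold x (T_fold m 1 + 3) + 3)).
- by value_tac.
- by value_tac.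
move=> x; finish; first betas; first exact: mul_runs.
by lia.
Qed.
#[global] Opaque Exp.

(** * Approximation from graphs of the family *)

(** The image of [f] induces a subgraph of [G1], and [f] is an isomorphism onto it. This carries
    membership in [H] to graphs on other vertex types, such as [list_graph], whose vertices are
    ordinals. *)
Lemma family_embed (H : graph_family) (G1 G2 : sgraph) (f : G2 -> G1) :
  well_behaved H -> injective f -> (forall x y, edge (f x) (f y) = edge x y) ->
  H G1 -> H G2.
Proof.
move=> [Hiso Hher _] inj_f edge_f HG1.
pose A := [set f x | x : G2]; have fA x : f x \in A by apply: imset_f.
apply: (Hiso (induced A)); last exact: Hher.
pose g (x : G2) : induced A := exist _ (f x) (fA x).
have inj_g : injective g by move=> x y /(congr1 val) /inj_f.
have [h gK hK] : bijective g.
  apply: inj_card_bij => //; rewrite card_sig -(card_imset predT inj_f).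
  by apply/subset_leq_card/subsetP=> x; rewrite inE.
exists h; first by exists g.
by move=> x y; rewrite -edge_f -[edge x y]/(edge (val x) (val y)) -{2}[x]hK -{2}[y]hK.
Qed.

Definition base_fptas (H : graph_family) : Prop :=
  exists (A : term) (f : rat -> nat) (c : nat),
    [/\ closed_term A,
        exists2 F : term, closed_term F & forall eps, is_eps eps ->
          exists k, evals (app F (enc_rat eps)) k (enc_nat (f eps))
      & forall (G : sgraph) (eps : rat), H G -> is_eps eps ->
        exists (k : nat) (s : seq G),
          [/\ evals (app (app A (enc_graph G)) (enc_rat eps)) k
                (enc_list (@enc_elt G) s),
              k <= f eps * tsize (enc_graph G) ^ c,
              uniq s, independent [set x in s]
            & ((1 - eps) * (opt G)%:R <= (size s)%:R)%R]].

Lemma value_rat q : is_value (enc_rat q).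
Proof. by rewrite /enc_rat; value_tac. Qed.
#[export] Hint Resolve value_rat : val.

(** A boolean has size at most 4 and a cons adds 5, so a row has size at most [n * 9 + 4]; the list
    of rows is counted in the same way. *)
Definition S_graph n := n * (n * 9 + 4 + 5) + 4.

Lemma tsize_list_leq T (e : T -> term) l m :
  (forall x, tsize (e x) <= m) -> tsize (enc_list e l) <= size l * (m + 5) + 4.
Proof.
move=> le_m; rewrite tsize_list leq_add2r; elim: l => [|x l IHl]; first by rewrite big_nil.
by rewrite big_cons mulSn leq_add // leq_add2r.
Qed.

Lemma size_leq_tsize T (e : T -> term) l : size l <= tsize (enc_list e l).
Proof.
rewrite tsize_list; elim: l => [|x l IHl] //; rewrite big_cons /=; lia.
Qed.

Lemma tsize_graph (G : sgraph) : tsize (enc_graph G) <= S_graph #|G|.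
Proof.
have le9 x : tsize (enc_list (fun y : G => enc_bool (edge x y)) (enum G)) <= #|G| * 9 + 4.
  by rewrite [X in X * 9](cardE G); apply: (@tsize_list_leq _ _ _ 4) => y; apply: tsize_bool.
rewrite /S_graph {1}(cardE G); exact: tsize_list_leq.
Qed.

Lemma poly_S_graph : poly S_graph.
Proof. by rewrite /S_graph; poly_cost. Qed.

Lemma S_graph_leq m n : m <= n -> S_graph m <= S_graph n.
Proof. by rewrite /S_graph => le_mn; nia. Qed.

Section Core.
Variables (H : graph_family) (A : term) (f : rat -> nat) (c : nat).
Hypotheses (hH : well_behaved H) (cA : closed_term A).
Hypothesis AP : forall (G : sgraph) (eps : rat), H G -> is_eps eps ->
  exists (k : nat) (s : seq G),
    [/\ evals (app (app A (enc_graph G)) (enc_rat eps)) k (enc_list (@enc_elt G) s),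
        k <= f eps * tsize (enc_graph G) ^ c,
        uniq s, independent [set x in s]
      & ((1 - eps) * (opt G)%:R <= (size s)%:R)%R].

Definition T_base n := T_solve n (n * S_graph n ^ c).
Definition T_core n := T_main n (T_base n).

Lemma poly_core : poly T_core.
Proof.
apply: poly_main; apply: poly_solve; apply: poly_mul poly_id _.
exact/poly_exp/poly_S_graph.
Qed.

Section Instance.
Variables (G : sgraph) (D : decomposition G) (eps : rat) (N : nat).
Hypotheses (gD : good D H) (eps01 : is_eps eps).
Hypotheses (leGN : #|G| <= N) (leDN : #|D| <= N) (lefN : f eps <= N).

Definition solves (U s : seq G) : Prop :=
  [/\ runs (app (app (app (Solve A) (enc_graph G)) (enc_rat eps))
                (enc_list (@enc_elt G) U)) (T_base N) (enc_list (@enc_elt G) s),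
      uniq s, {subset s <= U}, all (nadj s) s &
      forall I : {set G}, independent I -> {subset I <= U} ->
        ((1 - eps) * #|I|%:R <= (size s)%:R)%R].

Lemma solve_correct (t : D) (U : seq G) : uniq U -> {subset U <= base_list t} ->
  exists s : seq G, solves U s.
Proof.
move=> uU sU; pose tU := tnth (in_tuple U).
have memU i : tU i \in bag t :&: base D.
  by rewrite inE -mem_base sU // (mem_tnth i (in_tuple U)).
have inj_tU : injective tU by apply/tuple_uniqP.
have HU : H (list_graph U).
  pose g (i : list_graph U) : induced (bag t :&: base D) := exist _ (tU i) (memU i).
  apply: (@family_embed H _ _ g) (good_family gD t) => //.
  by move=> i j /(congr1 val) /inj_tU.
have [k [s [ev le_k us is_ le_s]]] := AP HU eps01.
have leU : size U <= N := size_uniq_leq leGN uU.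
have les : size s <= N.
  by apply: size_uniq_leq us; rewrite card_ord.
exists (map tU s); split.
- apply: runs_leq (solve_runs cA (value_rat eps) leGN leU les (ex_intro2 _ _ k (leqnn k) ev)) _.
  rewrite /T_base /T_solve !leq_add2r leq_add2l; apply: leq_trans le_k _.
  apply: leq_mul => //; apply: leq_expl; apply: leq_trans (tsize_graph _) _.
  by apply: S_graph_leq; rewrite card_ord.
- by rewrite map_inj_uniq.
- by move=> _ /mapP[i _ ->]; apply: (mem_tnth i (in_tuple U)).
- apply/allP=> _ /mapP[j js ->]; apply/nadjP=> _ /mapP[i is__ ->].
  move/forall_inP: is_ => /(_ i); rewrite inE => /(_ is__) /forall_inP /(_ j).
  by rewrite inE => /(_ js).
move=> I indI sIU; rewrite size_map; apply: le_trans le_s.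
have /andP[_ lt_eps1] := eps01; rewrite ler_wpM2l ?subr_ge0 ?(ltW lt_eps1) // ler_nat.
(* The preimage of [I] in the renumbered graph shows that the optimum there is at least [#|I|]. *)
pose J := [set i : list_graph U | tU i \in I].
have indJ : independent J.
  apply/forall_inP=> i; rewrite inE => iJ; apply/forall_inP=> j; rewrite inE => jJ.
  exact: (forall_inP (forall_inP indI _ iJ)).
apply: leq_trans (leq_bigmax_cond _ indJ).
rewrite -(card_imset _ inj_tU); apply/subset_leq_card/subsetP=> v vI.
have /tnthP[i def_v] : v \in in_tuple U by apply: sIU.
by apply/imsetP; exists i; rewrite // inE /tU -def_v.
Qed.

Lemma core_correct p : (forall t : D, #|bag t :\: base D| <= p) -> 2 ^ p <= N ->
  exists s : seq G,
    [/\ runs (app (app (app (Main (Solve A)) (enc_graph G)) (enc_decomposition D))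
                  (enc_rat eps)) (T_core N) (enc_list (@enc_elt G) s),
        uniq s, independent [set x in s]
      & ((1 - eps) * (opt G)%:R <= (size s)%:R)%R].
Proof.
move=> leB le2N.
pose cond U := exists2 t : D, uniq U & {subset U <= base_list t}.
(* The tables need a solver that is a function of the list alone, whereas solutions are only known
   to exist, for duplicate-free lists inside the base of some node. Choice picks one, and [[::]]
   fills the other cases. *)
have [U|sol solP] := @functional_choice _ _ (fun U s => cond U -> solves U s).
  have [[t uU sU]|no_t] := classic (cond U); last by exists [::].
  by have [s sP] := solve_correct uU sU; exists s.
have {}solP t U uU sU := solP U (ex_intro2 _ _ t uU sU).
have /andP[gt_eps0 lt_eps1] := eps01.
have a_ge0 : (0 <= 1 - eps)%R by rewrite subr_ge0 ltW.
have a_le1 : (1 - eps <= 1)%R by rewrite lerBlDr lerDl ltW.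
have solP' t U uU sU := let: And5 _ h2 h3 h4 h5 := solP t U uU sU in And4 h2 h3 h4 h5.
have [uK iK leK] := answer_correct gD a_ge0 a_le1 solP'.
exists (answer D sol); split=> //.
have le2C (t : D) : 2 ^ size (core_list t) <= N.
  by apply: leq_trans le2N; rewrite size_core leq_exp2l.
apply: (main_runs leGN leDN (value_Solve cA) (value_rat eps) _ le2C) => [t U uU sU|i t].
  by have [] := solP t U uU sU.
split=> /=; last first.
  (* Soundness enters the running time here: entries are duplicate-free, hence at most [N] long. *)
  by apply/allP=> F /(table_sound gD solP')[uF _ _]; apply: size_uniq_leq uF.
case: i => // i; rewrite tableS size_map size_filter; apply: leq_trans (count_size _ _) _.
by rewrite size_subsets.
Qed.
End Instance.
End Core.

(** * Reductions *)

Section Reductions.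
Variables (H : graph_family) (P : parameter).
Hypothesis hH : well_behaved H.
Hypothesis value_witness : forall G (w : witness P G), is_value (enc_witness w).

Lemma base_of_param (W : term) (T S : nat -> nat) :
  is_value W -> poly T -> poly S ->
  (forall G, H G -> exists w : witness P G,
     [/\ wvalid w, wmeasure w = 0, tsize (enc_witness w) <= S #|G|
       & forall N, #|G| <= N ->
           runs (app W (enc_graph G)) (T N) (enc_witness w)]) ->
  (forall m n, m <= n -> S m <= S n) ->
  independent_set_fptas P -> base_fptas H.
Proof.
move=> vW pT pS WP monoS [A [f [c [cA [F cF FP] AP]]]].
(* The terms pay for the scheme on an input of size at most [n + S n], for the construction of the
   witness, and for the glue. *)
pose T' n := (n + S n) ^ c + T n + 20.
have [d leT'] : exists d, forall n, 1 < n -> T' n <= n ^ d.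
  by apply: poly_leq; rewrite /T'; poly_cost.
pose A' := program (fn M e => A $ M $ (W $ M) $ e).
pose F' := program (fn e => Succ $ (F $ enc_nat 0 $ e)).
(* With the successor, the product also absorbs the additive cost [T n + 20], even if [f 0 eps] is
   zero. *)
exists A', (fun eps => (f 0 eps).+1), d; split.
- by apply: value_closed; unfold_program A'; value_tac.
- exists F'.
    by apply: value_closed; unfold_program F'; value_tac.
  move=> eps eps01; have [k ev] := FP 0 eps eps01.
  have r : runs (app (app F (enc_nat 0)) (enc_rat eps)) k (enc_nat (f 0 eps)).
    by exists k.
  have [K [k' _ ev']] : exists K, runs (app F' (enc_rat eps)) K (enc_nat (f 0 eps).+1).
    eexists; unfold_program F'; betas.
    by call r; apply: succ_runs.
  by exists k'.
move=> G eps HG eps01; have [w [valw mw szw rw]] := WP G HG.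
have pv : param_value P G 0 by split=> //; exists w.
have [k [s [ev le_k us is_ le_s]]] := AP G w 0 eps pv valw mw eps01.
set n := tsize (enc_graph G); have leGn : #|G| <= n by rewrite cardE; apply: size_leq_tsize.
have n_gt1 : 1 < n by rewrite /n tsize_list; lia.
have r : runs (app (app (app A (enc_graph G)) (enc_witness w)) (enc_rat eps)) k
  (enc_list (@enc_elt G) s) by exists k.
have [k' le_k' ev'] : runs (app (app A' (enc_graph G)) (enc_rat eps)) (k + T n + 20)
    (enc_list (@enc_elt G) s).
  finish; first unfold_program A'; first betas.
    call (rw n leGn).
    exact: r.
  by lia.
exists k', s; split=> //; apply: leq_trans le_k' _.
apply: leq_trans (leq_mul (leqnn _) (leT' n n_gt1)).
have : k <= f 0 eps * (n + S n) ^ c.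
  apply: leq_trans le_k _; rewrite leq_mul // leq_expl // leq_add2l.
  exact: leq_trans szw (monoS _ _ leGn).
rewrite /T'; move: (f 0 eps) ((n + S n) ^ c) (T n) => x y z; nia.
Qed.

(** The bound [(wmeasure w).+1] on the cores suits all three measures: the width is one less than
    the largest core (or 0), a path with [d] edges has [d + 1] nodes, and a modulator has one to
    spare. *)
Lemma param_of_base (W : term) (T : nat -> nat) :
  is_value W -> poly T ->
  (forall G (w : witness P G), wvalid w -> exists D : decomposition G,
     [/\ good D H, forall t : D, #|bag t :\: base D| <= (wmeasure w).+1,
         #|D| <= tsize (enc_witness w)
       & forall N, #|G| <= N -> tsize (enc_witness w) <= N ->
           runs (app (app W (enc_graph G)) (enc_witness w)) (T N)
             (enc_decomposition D)]) ->
  base_fptas H -> independent_set_fptas P.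
Proof.
move=> vW pT WP [A [f [c [cA [F cF FP] AP]]]].
pose T' n := T_core c n + T n + 20.
have [d leT'] : exists d, forall n, 1 < n -> T' n <= n ^ d.
  by have pc := poly_core c; apply: poly_leq; rewrite /T'; poly_cost.
have vMain := value_Main (value_Solve cA).
pose A' := program (fn M w e => Main (Solve A) $ M $ (W $ M $ w) $ e).
pose m p eps := 2 ^ p.+1 * (f eps).+1.
pose F' := program (fn p e => Exp
  $ (Mul $ (Exp $ enc_nat 2 $ (Succ $ p)) $ (Succ $ (F $ e))) $ enc_nat d).
exists A', (fun p eps => m p eps ^ d), d; split.
- by apply: value_closed; unfold_program A'; value_tac.
- exists F'.
    by apply: value_closed; unfold_program F'; value_tac.
  move=> p eps eps01; have [k ev] := FP eps eps01.
  have r : runs (app F (enc_rat eps)) k (enc_nat (f eps)) by exists k.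
  have [K1 r1] := exp_runs 2 p.+1; have [K2 r2] := exp_runs (m p eps) d.
  have [K [k' _ ev']] : exists K, runs (app (app F' (enc_nat p)) (enc_rat eps)) K
      (enc_nat (m p eps ^ d)).
    eexists; unfold_program F'; betas.
    call r; call (succ_runs (f eps)); call (succ_runs p); call r1.
    call (mul_runs (2 ^ p.+1) (f eps).+1).
    exact: r2.
  by exists k'.
move=> G w p eps _ valw mw eps01 n; have [D [gD leB leD rD]] := WP G w valw.
have leGn : #|G| <= n by rewrite cardE; apply: leq_trans (size_leq_tsize _ _) (leq_addr _ _).
have n_gt1 : 1 < n by rewrite /n tsize_list; lia.
have m_gt0 : 0 < m p eps by rewrite muln_gt0 expn_gt0.
pose N := n * m p eps.
have le_nN : n <= N by rewrite leq_pmulr.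
have le_mN : m p eps <= N by rewrite leq_pmull // ltnW.
have le2N : 2 ^ p.+1 <= N by apply: leq_trans le_mN; rewrite leq_pmulr.
have lefN : f eps <= N.
  by apply: leq_trans le_mN; apply: leq_trans (leqnSn _) _; rewrite leq_pmull ?expn_gt0.
have leGN := leq_trans leGn le_nN.
have lewN : tsize (enc_witness w) <= N by apply: leq_trans (leq_addl _ _) le_nN.
rewrite mw in leB.
have [s [r us is_ le_s]] := core_correct hH cA AP gD eps01 leGN (leq_trans leD lewN) lefN leB le2N.
have [k le_k ev] : runs (app (app (app A' (enc_graph G)) (enc_witness w)) (enc_rat eps))
    (T' N) (enc_list (@enc_elt G) s).
  finish; first unfold_program A'; first betas.
    call (rD N leGN lewN).
    exact: r.
  by rewrite /T'; lia.
exists k, s; split=> //; apply: leq_trans le_k _.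
by rewrite -expnMn mulnC; apply: leT'; apply: leq_trans le_nN.
Qed.
End Reductions.

(** * Modulators and trivial decompositions *)

Lemma filter_enum (T : finType) (A : {set T}) : [seq x <- enum T | x \in A] = enum A.
Proof. by rewrite enumT; apply: eq_filter. Qed.

Definition trivial_forest : forest :=
  @Forest unit (fun=> None) (fun t => ex_intro _ 1 (erefl None)).

(** With [S] empty this is also the witness of depth and width 0 for a graph of [H], so one
    conversion program serves several reductions. *)
Definition mod_decomposition (G : sgraph) (S : {set G}) : decomposition G :=
  @Decomposition G trivial_forest (fun=> setT) (~: S).

Lemma trivial_leaf (t : trivial_forest) : is_leaf t.
Proof. exact/forallP. Qed.

Lemma trivial_ancestor (s t : trivial_forest) : ancestor s t.
Proof. by case: s; case: t; apply: ancestor_refl. Qed.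

Lemma mod_decomposition_good (H : graph_family) (G : sgraph) (S : {set G}) :
  is_modulator H S -> good (mod_decomposition S) H.
Proof.
move=> modS; split=> /=.
- by move=> v; exists tt; rewrite inE.
- by move=> *; apply: trivial_ancestor.
- by [].
- by move=> u v _; exists tt; rewrite !inE.
- by move=> v [] [].
by move=> t; rewrite setTI.
Qed.

Lemma family_induced (H : graph_family) (G : sgraph) (A : {set G}) :
  well_behaved H -> H G -> H (induced A).
Proof. by case=> _ Hher _; apply: Hher. Qed.

Lemma enc_mod_decomposition (G : sgraph) (S : {set G}) :
  enc_decomposition (mod_decomposition S) =
  enc_pair (enc_list (fun t : trivial_forest =>
      enc_pair (enc_option (@enc_elt trivial_forest) (parent t)) (enc_set [set: G]))
      [:: tt]) (enc_set (~: S)).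
Proof.
rewrite /enc_decomposition; congr (enc_pair (enc_list _ _) _).
by rewrite enumT unlock.
Qed.

Definition Mod_conv : term := program (fn M S =>
  Pair $ (Cons $ (Pair $ enc_option enc_nat None $ (Iota $ M)) $ Nil)
       $ (Filter $ (fn v => Not $ (Mem $ v $ S)) $ (Iota $ M))).

Lemma value_Mod_conv : is_value Mod_conv.
Proof. by unfold_program Mod_conv; value_tac. Qed.
#[export] Hint Resolve value_Mod_conv : val.

Definition T_mod N := T_iota N + T_iota N + T_list N (T_mem N + 10) + 20.

Lemma poly_mod : poly T_mod.
Proof. by rewrite /T_mod; poly_cost. Qed.

Lemma size_enum_leq (T : finType) (A : {set T}) N : #|T| <= N -> size (enum A) <= N.
Proof. by rewrite -cardE; apply: leq_trans (max_card _). Qed.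

Lemma enum_graph_runs (G : sgraph) N : #|G| <= N ->
  runs (app Iota (enc_graph G)) (T_iota N) (enc_list (@enc_elt G) (enum G)).
Proof.
by move=> leGN; apply: enum_runs => //; [value_tac | rewrite -cardE].
Qed.

Lemma mod_conv_runs (G : sgraph) (S : {set G}) N : #|G| <= N ->
  runs (app (app Mod_conv (enc_graph G)) (enc_set S)) (T_mod N)
    (enc_decomposition (mod_decomposition S)).
Proof.
move=> leGN; rewrite enc_mod_decomposition; finish; first unfold_program Mod_conv; first betas.
  call (enum_graph_runs leGN); call (enum_graph_runs leGN).
  rewrite /enc_set.
  call (@filter_runs _ (@enc_elt G) _ _ (fun v => v \in ~: S) _ (T_mem N + 10) N).
      by rewrite -cardE.
    move=> v _; finish; first betas.
      call (mem_runs leGN v (size_enum_leq S leGN)).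
      by rewrite mem_enum in_setC; apply: not_runs.
    by lia.
  rewrite filter_enum enumT -enum_setT (enc_noneE _ (@enc_elt trivial_forest)).
  call (@pair_runs (enc_option (@enc_elt trivial_forest) None)
    (enc_list (@enc_elt G) (enum setT))).
  pose e (t : trivial_forest) :=
    enc_pair (enc_option (@enc_elt trivial_forest) (parent t)) (enc_set [set: G]).
  have ve t : is_value (e t) by rewrite /e; value_tac.
  rewrite (NilE e); call (@cons_runs _ e tt [::] ve).
  by apply: pair_runs; value_tac.
by rewrite /T_mod; lia.
Qed.
#[global] Opaque Mod_conv.

Definition S_mod n := n * (4 * n + 4 + 5) + n * (4 * n + 4 + 5) + 40.

Lemma tsize_set (T : finType) (A : {set T}) :
  tsize (enc_set A) <= #|T| * (4 * #|T| + 4 + 5) + 4.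
Proof.
apply: leq_trans (tsize_list_leq _ (m := 4 * #|T| + 4) _) _ => [x|].
  by rewrite enc_eltE tsize_nat leq_add2r leq_mul2l; apply/orP; right; apply: ltnW.
by rewrite leq_add2r leq_mul2r -cardE max_card orbT.
Qed.

Lemma tsize_mod (G : sgraph) (S : {set G}) :
  tsize (enc_decomposition (mod_decomposition S)) <= S_mod #|G|.
Proof.
rewrite enc_mod_decomposition tsize_pair tsize_list.
rewrite big_cons big_nil tsize_pair tsize_none.
have := tsize_set [set: G]; have := tsize_set (~: S); rewrite /S_mod /=; lia.
Qed.

Lemma poly_S_mod : poly S_mod. Proof. by rewrite /S_mod; poly_cost. Qed.

Lemma S_mod_leq m n : m <= n -> S_mod m <= S_mod n.
Proof. by rewrite /S_mod => le_mn; nia. Qed.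

Lemma card_decomposition (G : sgraph) (D : decomposition G) :
  #|D| <= tsize (enc_decomposition D).
Proof.
rewrite tsize_pair cardE.
apply: leq_trans (leq_trans (leq_addr _ _) (leq_addr _ _)); exact: size_leq_tsize.
Qed.

Section ModulatorAndTrivial.
Variables (H : graph_family).
Hypothesis hH : well_behaved H.

Lemma base_of_mod : independent_set_fptas (mod_param H) -> base_fptas H.
Proof.
apply: (@base_of_param H (mod_param H) (program (fn M => Nil)) (fun=> 1) (fun=> 4)) => //.
- exact: poly_const.
- exact: poly_const.
move=> G HG; exists (set0 : {set G}); split=> /=.
- exact: family_induced.
- exact: cards0.
- by rewrite /enc_set enum_set0 tsize_list big_nil.
move=> N _; finish; first expose; first betas.
  by rewrite /enc_set enum_set0 -(NilE (@enc_elt G)); ret.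
by [].
Qed.

Lemma mod_of_base : base_fptas H -> independent_set_fptas (mod_param H).
Proof.
apply: (@param_of_base H (mod_param H) hH _ Mod_conv T_mod) => //.
- by move=> G w; apply: value_set.
- exact: poly_mod.
move=> G S modS; exists (mod_decomposition S); split.
- exact: mod_decomposition_good.
- by move=> t /=; rewrite setTD setCK; apply: leqnSn.
- by rewrite card_unit /= tsize_list; lia.
by move=> N leGN _; apply: mod_conv_runs.
Qed.

Definition Triv : term := program (fn M => Mod_conv $ M $ Nil).

Lemma triv_runs (G : sgraph) N : #|G| <= N ->
  runs (app Triv (enc_graph G)) (T_mod N + 1)
    (enc_decomposition (mod_decomposition (set0 : {set G}))).
Proof.
move=> leGN; finish; first unfold_program Triv; first betas.
  have -> : Nil = enc_set (set0 : {set G}).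
    by rewrite /enc_set enum_set0 -(NilE (@enc_elt G)).
  exact: (mod_conv_runs _ leGN).
by lia.
Qed.

Lemma base_of_decomposition (P : parameter) :
  (forall G, H G -> exists2 w : witness P G, wvalid w /\ wmeasure w = 0 &
     enc_witness w = enc_decomposition (mod_decomposition (set0 : {set G}))) ->
  independent_set_fptas P -> base_fptas H.
Proof.
move=> wP; apply: (@base_of_param H P Triv (fun n => T_mod n + 1) S_mod) => //.
- by apply: poly_add poly_mod (poly_const _).
- exact: poly_S_mod.
- move=> G HG; have [w [vw mw] ew] := wP G HG; exists w; rewrite ew; split=> //.
    exact: tsize_mod.
  by move=> N; apply: triv_runs.
exact: S_mod_leq.
Qed.

Lemma base_of_ed : independent_set_fptas (ed_param H) -> base_fptas H.
Proof.
apply: base_of_decomposition => G HG.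
exists (mod_decomposition (set0 : {set G})); split=> //=.
  split=> /= [t|v|t _|v _|u v s t _ _ _].
  - by rewrite trivial_leaf.
  - by exists tt; split=> [|[] //]; rewrite inE.
  - by rewrite setC0 subsetT; split=> //; apply: family_induced.
  - by exists tt; split=> [|[] //]; rewrite inE trivial_leaf.
  by rewrite trivial_ancestor.
apply/eqP; rewrite -leqn0; apply/bigmax_leqP=> [[]] _.
by rewrite leqn0 cards_eq0; apply/eqP/setP=> [[]]; rewrite !inE eqxx andbF.
Qed.

Lemma base_of_tw : independent_set_fptas (tw_param H) -> base_fptas H.
Proof.
apply: base_of_decomposition => G HG.
exists (mod_decomposition (set0 : {set G})); split=> //=.
  split=> /= [|v|u v _|v _|t _].
  - by apply/cards1P; exists tt; apply/setP=> [[]]; rewrite !inE /is_root !eqxx.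
  - split; first by exists tt; rewrite inE.
    by move=> [] [] _ _; apply: connect0.
  - by exists tt; rewrite !inE.
  - by exists tt; [exact: trivial_leaf | case; rewrite inE].
  exact: family_induced.
rewrite /width; apply/eqP; rewrite -leqn0 -subn1 leq_subLR.
by apply/bigmax_leqP=> t _ /=; rewrite setC0 setDT cards0.
Qed.

End ModulatorAndTrivial.

(** * Tree and elimination decompositions *)

Section FamilySubset.
Variables (H : graph_family) (hH : well_behaved H) (G : sgraph).

Lemma induced_subset (A B : {set G}) : B \subset A -> H (induced A) -> H (induced B).
Proof.
move=> sBA; pose f (x : induced B) : induced A := exist _ (val x) (subsetP sBA _ (valP x)).
by apply: (@family_embed H _ _ f) => // x y /(congr1 val) /= /val_inj.
Qed.
End FamilySubset.

Section TreeDecomposition.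
Variables (H : graph_family) (hH : well_behaved H) (G : sgraph) (D : decomposition G).
Hypothesis treeD : is_tree_decomposition H D.

(* The only edge of T leaving the subtree rooted at s is the one to its parent. *)
Lemma subtree_closed (s : D) (v : G) :
  (v \notin bag s) || (v \notin obag (parent s)) ->
  forall r r' : D, ancestor s r -> v \in bag r -> v \in bag r' -> ancestor s r'.
Proof.
move=> vs r r' anc_r vr vr'; have [_ connD _ _ _] := treeD.
have [_ conn_v] := connD v.
have step x y : v \in bag x -> v \in bag y -> parent x = Some y ->
    ancestor s x = ancestor s y.
  move=> vx vy par_x; apply/idP/idP; last first.
    by move=> anc; apply: ancestor_trans anc (ancestor_parent par_x).
  case/ancestor_cases=> [eq_sx|[z]]; last by rewrite par_x => -[<-].
  by move: vs; rewrite eq_sx par_x /= vx vy.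
have clos : closed [rel x y : D | [&& x \in [set t : D | v \in bag t],
    y \in [set t : D | v \in bag t] & tree_adj x y]] [pred x | ancestor s x].
  move=> x y /= /and3P[]; rewrite !inE => vx vy /orP[] /eqP par.
    exact: step.
  by apply/esym; apply: step.
have := closed_connect clos (conn_v r r' _ _); rewrite !inE => <- //.
Qed.

Lemma tree_decomposition_good : good D H.
Proof.
have [_ connD edgeD baseD leafD] := treeD.
split=> [v|s r r' v vo|s t r v par_s vt anc_r vr|//|v s t vb vs vt|t].
- by have [] := connD v.
- by apply: subtree_closed; rewrite vo orbT.
(* If [v] were missing from the bag of [s], no walk through bags containing [v] could leave the
   subtree of [s], so [t] would lie in it. *)
- apply: contraT => vs; have := ancestor_parentN par_s.
  by rewrite (@subtree_closed s v _ r t) ?vs.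
- have [l _ bagE] := baseD v vb; move: vs vt; rewrite !bagE => /eqP-> /eqP->.
  by [].
have [leaf_t|leafN] := boolP (is_leaf t); first exact: leafD.
(* At an internal node the base part of the bag is empty, and heredity gives the empty graph from
   any leaf. *)
have [l leaf_l _] := leaf_below t.
apply: induced_subset (leafD l leaf_l) => //; apply/subsetP=> v.
rewrite inE => /andP[vt vb]; have [l' leaf_l' bagE] := baseD v vb.
by move: vt leafN; rewrite bagE => /eqP->; rewrite leaf_l'.
Qed.

Lemma width_core (t : D) : #|bag t :\: base D| <= (width D).+1.
Proof.
exact: leq_trans (leq_bigmax (F := fun s : D => #|bag s :\: base D|) t) (leqSpred _).
Qed.
End TreeDecomposition.

Lemma tw_of_base (H : graph_family) :
  well_behaved H -> base_fptas H -> independent_set_fptas (tw_param H).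
Proof.
move=> hH; apply: (@param_of_base H (tw_param H) hH _ (program (fn M D => D)) (fun=> 2)) => //.
- by move=> G w; apply: value_decomposition.
- exact: poly_const.
move=> G D treeD; exists D; split.
- exact: tree_decomposition_good.
- exact: width_core.
- exact: card_decomposition.
move=> N _ _; finish; first expose; first betas; first ret.
by [].
Qed.

Section ElimDecomposition.
Variables (G : sgraph) (D : decomposition G).

Definition up_bag (t : D) : {set G} := [set v | [exists a : D, ancestor a t && (v \in bag a)]].

Definition elim_decomposition : decomposition G :=
  @Decomposition G (dforest D) up_bag (base D).

Lemma up_bagP (t : D) v : reflect (exists2 a : D, ancestor a t & v \in bag a) (v \in up_bag t).
Proof. by rewrite inE; apply: (iffP exists_inP). Qed.

Section Good.
Variables (H : graph_family) (hH : well_behaved H).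
Hypothesis elimD : is_elim_decomposition H D.

Lemma home_uniq v (s t : D) : v \in bag s -> v \in bag t -> s = t.
Proof.
have [_ uD _ _ _] := elimD; have [r [_ r_uniq]] := uD v.
by move=> /r_uniq <- /r_uniq.
Qed.

Lemma home_base v (t : D) : v \in base D -> v \in bag t -> is_leaf t.
Proof.
have [_ _ _ bD _] := elimD; move=> /bD[l [[leaf_l vl] _]] vt.
by rewrite (home_uniq vt vl).
Qed.

(** Base vertices live in leaf bags, and a leaf is an ancestor of itself only, so collecting the
    bags of ancestors never copies a base vertex. *)
Lemma up_bag_base v (t : D) : v \in base D -> v \in up_bag t -> v \in bag t.
Proof.
move=> vb /up_bagP[a anc_a va].
by rewrite (leaf_ancestor (home_base vb va) anc_a).
Qed.

Lemma elim_decomposition_good : good elim_decomposition H.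
Proof.
have [internalD uD leafD _ edgeD] := elimD.
split=> /=.
- move=> v; have [t [vt _]] := uD v; exists t.
  by apply/up_bagP; exists t; first exact: ancestor_refl.
- move=> s r r' v vo anc_r /up_bagP[a anc_a va] /up_bagP[a' anc_a' va'].
  rewrite -(home_uniq va va') in anc_a'; apply: ancestor_trans anc_a'.
  (* Both [s] and the home [a] of [v] are ancestors of [r], hence comparable. Were [a] strictly
     above [s], [v] would be in the collected bag of the parent of [s], which is excluded. *)
  have [//|/ancestor_cases[->|[t par_s anc_t]]] := ancestor_comparable anc_r anc_a.
    exact: ancestor_refl.
  by case/negP: vo; rewrite /obag par_s; apply/up_bagP; exists a.
- move=> s t r v par_s /up_bagP[a anc_a va] _ _; apply/up_bagP; exists a => //.
  exact: ancestor_trans anc_a (ancestor_parent par_s).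
- move=> u v uv; have [s [us _]] := uD u; have [t [vt _]] := uD v.
  have /orP[anc|anc] := edgeD u v s t uv us vt; [exists t | exists s]; split.
  + by apply/up_bagP; exists s.
  + by apply/up_bagP; exists t; first exact: ancestor_refl.
  + by apply/up_bagP; exists s; first exact: ancestor_refl.
  by apply/up_bagP; exists t.
- move=> v s t vb /(up_bag_base vb) vs /(up_bag_base vb) vt.
  exact: home_uniq vs vt.
move=> t; have [l leaf_l _] := leaf_below t.
have [leaf_t|leafN] := boolP (is_leaf t).
  apply: induced_subset (proj2 (leafD t leaf_t)) => //; apply/subsetP=> v.
  by rewrite inE => /andP[vt vb]; apply: up_bag_base.
apply: induced_subset (proj2 (leafD l leaf_l)) => //; apply/subsetP=> v.
rewrite inE => /andP[vt vb]; case/negP: leafN.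
exact: home_base vb (up_bag_base vb vt).
Qed.

(** The home of a core vertex is an internal node, whose bag has at most one vertex. So [home] maps
    the core injectively into the ancestors of [t], of which there are [node_depth t + 1], counting
    [t]. *)
Lemma elim_core (t : D) : #|up_bag t :\: base D| <= (depth D).+1.
Proof.
have [internalD uD leafD _ _] := elimD.
apply: leq_trans (_ : _ <= (node_depth t).+1) _; last by rewrite ltnS node_depth_leq.
pose anc := [set a : D | ancestor a t].
have -> : (node_depth t).+1 = #|anc|.
  rewrite (cardsD1 t) !inE ancestor_refl add1n; congr _.+1.
  by apply: eq_card => a; rewrite !inE andbC.
pose home v := odflt t [pick a : D | v \in bag a].
have homeP v a : v \in bag a -> home v = a.
  by rewrite /home => va; case: pickP => [b vb|/(_ a)/idP[]//]; apply: home_uniq vb va.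
have inj_home : {in up_bag t :\: base D &, injective home}.
  move=> u v; rewrite !inE => /andP[ub /exists_inP[a _ ua]] /andP[vb /exists_inP[b _ vb']].
  rewrite (homeP u a ua) (homeP v b vb') => eq_ab; rewrite -{b}eq_ab in vb'.
  have leafN : ~~ is_leaf a.
    by apply: contra ub => /leafD[/subsetP sub _]; apply: sub.
  have [/card_le1_eqP le1 _] := internalD a leafN.
  exact: le1.
rewrite -(card_in_imset inj_home); apply/subset_leq_card/subsetP=> a /imsetP[v].
by rewrite !inE => /andP[_ /exists_inP[b anc_b vb]] ->; rewrite (homeP v b vb).
Qed.
End Good.

Definition up_state : Type := (option D * seq G)%type.

(** The state holds the next ancestor to visit and the vertices collected so far. It is stationary
    once the root has been passed, so a loop of [#|D|] rounds may overshoot. *)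
Definition up_step (q : up_state) : up_state :=
  if q.1 is Some j then (parent j, enum (bag j) ++ q.2) else q.

Lemma up_stepP k (t : D) v :
  let q := iter k up_step (parent t, enum (bag t)) in
  q.1 = iter k.+1 (obind (@parent D)) (Some t) /\
  (v \in q.2 <-> exists2 j, j <= k &
     exists2 a : D, iter j (obind (@parent D)) (Some t) = Some a & v \in bag a).
Proof.
elim: k => [|k /= [def_q1 memq]].
  split=> //=; rewrite mem_enum; split=> [vt|[j]]; first by exists 0 => //; exists t.
  by rewrite leqn0 => /eqP-> [a [->]].
rewrite /up_step; set q := iter k _ _ in def_q1 memq *.
case def_a: q.1 => [a|] /=; rewrite -def_q1 def_a /=.
  split=> //; rewrite mem_cat mem_enum; split.
    case/orP=> [va|/memq[j le_j jP]]; last by exists j => //; apply: leqW.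
    by exists k.+1 => //; exists a; rewrite //= -def_q1.
  case=> j; rewrite leq_eqVlt => /orP[/eqP->|lt_j] [b up_b vb]; last first.
    by apply/orP; right; apply/memq; exists j => //; exists b.
  move: up_b; rewrite /= -def_q1 def_a => -[->].
  by rewrite vb.
split=> //.
rewrite memq; split=> -[j le_j [b up_b vb]].
  by exists j; [apply: leqW | exists b].
move: le_j; rewrite leq_eqVlt => /orP[/eqP def_j|lt_j]; last by exists j => //; exists b.
by move: up_b; rewrite def_j /= -def_q1 def_a.
Qed.

Lemma up_step_mem (t : D) v :
  (v \in (iter #|D| up_step (parent t, enum (bag t))).2) = (v \in up_bag t).
Proof.
have [_ memP] := up_stepP #|D| t v; apply/idP/up_bagP => [/memP[j _ [a up_a va]]|[a]].
  by exists a => //; apply/ancestorP; exists j.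
case/ancestorP=> j up_a va; apply/memP; exists j; last by exists a.
have [k le_k up_k] := up_card t; rewrite leqNgt; apply/negP=> lt_j.
have le_kj : k <= j by apply: leq_trans le_k (ltnW lt_j).
by move: up_a; rewrite -(subnK le_kj) iterD up_k iter_up_None.
Qed.

(** A crude count of one bag per round, the origin of [N.+1 * N] in [T_elim]. *)
Lemma size_up_step k (t : D) N : #|G| <= N ->
  size (iter k up_step (parent t, enum (bag t))).2 <= k.+1 * N.
Proof.
move=> leGN; elim: k => [|k IHk] /=; first by rewrite mul1n size_enum_leq.
rewrite /up_step; case: (iter k _ _).1 => [a|] /=; last by apply: leq_trans IHk _; rewrite leq_mul2r leqnSn orbT.
by rewrite size_cat mulSn leq_add ?size_enum_leq.
Qed.
End ElimDecomposition.

Definition Up_bag : term := program (fn nodes i =>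
  (Foldr $ (fn x q => q $ (fn o l =>
      o $ (fn j => (Nth $ nodes $ j) $ (fn p b => Pair $ p $ (Cat $ b $ l))) $ q))
    $ (Nth $ nodes $ i) $ nodes) $ (fn o l => l)).
(** Filtering the enumeration of all vertices restores the order of [enc_set], since the output must
    be literally the encoding of [elim_decomposition D]. *)
Definition Elim_conv : term := program (fn M D => D $ (fn nodes base =>
  Pair $ (Map $ (fn i => (Nth $ nodes $ i) $ (fn p b =>
    Pair $ p $ ((fn l => Filter $ (fn v => Mem $ v $ l) $ (Iota $ M))
                  $ (Up_bag $ nodes $ i)))) $ (Iota $ nodes)) $ base)).

Lemma value_Up_bag : is_value Up_bag.
Proof. by unfold_program Up_bag; value_tac. Qed.
#[export] Hint Resolve value_Up_bag : val.

Lemma value_Elim_conv : is_value Elim_conv.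
Proof. by unfold_program Elim_conv; value_tac. Qed.
#[export] Hint Resolve value_Elim_conv : val.

Definition T_up N := T_fold N (T_nth N + T_cat N + 20) + T_nth N + 20.
Definition T_elim N := T_list N (T_nth N + T_up N + T_iota N
  + T_list (N.+1 * N) (T_mem (N.+1 * N) + 10) + 40) + T_iota N + 40.

Section ElimProgram.
Variables (G : sgraph) (D : decomposition G) (N : nat).
Hypotheses (leGN : #|G| <= N) (leDN : #|D| <= N).
Local Notation eV := (@enc_elt G).
Local Notation eL := (enc_list eV).
Local Notation eO := (enc_option (@enc_elt D)).

Definition enc_up (q : up_state D) : term := enc_pair (eO q.1) (eL q.2).

Lemma value_up q : is_value (enc_up q).
Proof. by rewrite /enc_up; value_tac. Qed.
#[local] Hint Resolve value_up value_entry : val.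

Lemma entry_runs (t : D) :
  runs (app (app Nth (enc_list (@enc_entry G D) (enum D))) (enc_elt t)) (T_nth N)
    (enc_entry t).
Proof.
rewrite enc_eltE -{2}(nth_enum_rank t t); apply: nth_runs; first by value_tac.
  by rewrite -cardE; exact: (ltn_ord (enum_rank t)).
by rewrite -cardE.
Qed.

Lemma up_bag_runs (t : D) :
  runs (app (app Up_bag (enc_list (@enc_entry G D) (enum D))) (enc_elt t)) (T_up N)
    (eL (iter #|D| (@up_step G D) (parent t, enum (bag t))).2).
Proof.
finish; first unfold_program Up_bag; first betas.
  call (entry_runs t).
  have -> : enc_entry t = enc_up (parent t, enum (bag t)) by [].
  have iterE (l : seq D) y : foldr (fun=> @up_step G D) y l = iter (size l) (@up_step G D) y.
    by elim: l => //= x l ->.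
  call (@foldr_runs _ _ (@enc_entry G D) enc_up _ _ _ (fun=> @up_step G D)
    (parent t, enum (bag t)) (enum D) (T_nth N + T_cat N + 20) N).
      by rewrite -cardE.
    move=> x [o l] _; have -> : enc_up (o, l) = enc_pair (eO o) (eL l) by [].
    case: o => [j|]; finish.
    + betas; step steps_pair; [value_tac.. | betas].
      step steps_some; [value_tac.. | betas].
      call (entry_runs j); rewrite {1}/enc_entry /enc_set.
      step steps_pair; [value_tac.. | betas].
      call (@cat_runs _ eV _ (enum (bag j)) l N); first exact: size_enum_leq.
      by apply: pair_runs; value_tac.
    + by lia.
    + betas; step steps_pair; [value_tac.. | betas].
      by step steps_none; [value_tac.. | ret].
    by lia.
  rewrite iterE -cardE; set q := iter _ _ _.
  have -> : enc_up q = enc_pair (eO q.1) (eL q.2) by [].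
  by step steps_pair; [value_tac.. | betas; ret].
by rewrite /T_up; lia.
Qed.
#[global] Opaque Up_bag.

Lemma elim_conv_runs :
  runs (app (app Elim_conv (enc_graph G)) (enc_decomposition D)) (T_elim N)
    (enc_decomposition (elim_decomposition D)).
Proof.
have leD : size (enum D) <= N by rewrite -cardE.
have leN : N <= N.+1 * N by rewrite leq_pmull.
pose e (t : D) := enc_pair (eO (parent t)) (enc_set (up_bag t)).
have ve t : is_value (e t) by rewrite /e; value_tac.
have -> : enc_decomposition (elim_decomposition D) =
  enc_pair (enc_list e (enum D)) (enc_set (base D)) by [].
have -> : enc_decomposition D =
  enc_pair (enc_list (@enc_entry G D) (enum D)) (enc_set (base D)) by [].
finish; first unfold_program Elim_conv; first betas.
  step steps_pair; [value_tac.. | betas].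
  call (@enum_runs D N leDN _ (@enc_entry G D) (enum D)); first by rewrite -cardE.
  call (@map_enc_runs _ (@enc_elt D) e _ _ (T_nth N + T_up N + T_iota N
    + T_list (N.+1 * N) (T_mem (N.+1 * N) + 10) + 40) N).
    move=> t _; finish; first betas.
      call (entry_runs t); rewrite {1}/enc_entry; step steps_pair; [value_tac.. | betas].
      call (up_bag_runs t); betas.
      call (enum_graph_runs leGN).
      set l := (iter _ _ _).2.
      have lel : size l <= N.+1 * N.
        apply: leq_trans (size_up_step _ _ leGN) _.
        by rewrite leq_mul2r ltnS leDN orbT.
      call (@filter_runs _ eV _ _ (fun v => v \in up_bag t) _ (T_mem (N.+1 * N) + 10)
        (N.+1 * N)).
          by rewrite -cardE; apply: leq_trans leN.
        move=> v _; finish; first betas.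
          by rewrite -up_step_mem; apply: (mem_runs (leq_trans leGN leN) v lel).
        by lia.
      rewrite filter_enum.
      by apply: pair_runs; value_tac.
    by lia.
  by apply: pair_runs; value_tac.
by rewrite /T_elim; lia.
Qed.
#[global] Opaque Elim_conv.
End ElimProgram.

Lemma poly_elim : poly T_elim.
Proof.
have pN : poly (fun n => n.+1 * n).
  by apply: (@poly_mul S id); [exists 1 => n; rewrite expn1; lia | exact: poly_id].
have pM := poly_comp poly_mem pN.
have pU : poly T_up by rewrite /T_up; poly_cost.
rewrite /T_elim; apply: poly_add (poly_const _); apply: poly_add poly_iota.
apply: poly_list poly_id _; apply: poly_add (poly_const _); apply: poly_add.
  by poly_cost.
by apply: poly_list pN (poly_add pM (poly_const _)).
Qed.

Lemma ed_of_base (H : graph_family) :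
  well_behaved H -> base_fptas H -> independent_set_fptas (ed_param H).
Proof.
move=> hH; apply: (@param_of_base H (ed_param H) hH _ Elim_conv T_elim) => //.
- by move=> G w; apply: value_decomposition.
- exact: poly_elim.
move=> G D elimD; exists (elim_decomposition D); split.
- exact: elim_decomposition_good.
- exact: elim_core elimD.
- exact: card_decomposition.
move=> N leGN leDN; apply: elim_conv_runs => //.
exact: leq_trans (card_decomposition D) leDN.
Qed.

Theorem theorem6 (H : graph_family) (hH : well_behaved H) :
  (independent_set_fptas (mod_param H) <-> independent_set_fptas (ed_param H)) /\
  (independent_set_fptas (ed_param H) <-> independent_set_fptas (tw_param H)).
Proof.
split; split.
- by move/(base_of_mod hH)/(ed_of_base hH).
- by move/(base_of_ed hH)/(mod_of_base hH).
- by move/(base_of_ed hH)/(tw_of_base hH).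
by move/(base_of_tw hH)/(ed_of_base hH).
Qed.
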